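(* Let $\mathcal M\subset\Omega$ be a normally contracting invariant manifold of $\varphi^t$ with constants $\beta_0,\beta_*,k'$, and let $(\mathcal W^u,\mathcal O_0,F,\mathcal O_1)$ be unstable manifold data for $\mathcal M\times\{0\}$. Define $$\hat V(x):=\int_{-\infty}^0L\big(X_{x,F(x)}(t),\dot X_{x,F(x)}(t)\big)\,dt,\quad x\in\mathcal O_1,$$ where $L(x,v)=\frac14(b(x)-v)^\top A^{-1}(x)(b(x)-v)$. If $k'\ge2$, then $\hat V$ is well-defined, non-negative, and vanishes only on $\mathcal M$. Moreover, the following hold. (1) $\hat V\in C^{k'+1}(\mathcal O_1)$ and $\nabla\hat V=F$. (2) $H(x,\nabla\hat V(x))=0$ for $x\in\mathcal O_1$. (3) For each $x\in\mathcal M$, $\mathrm{Hess}(\hat V)|_x:T_x\mathbb R^d\otimes T_x\mathbb R^d\to\mathbb R$ is semi-positive definite and satisfies $\mathrm{Hess}(\hat V)|_x(y,z)=0$ if $y\in T_x\mathcal M$ or $z\in T_x\mathcal M$, and $\mathrm{Hess}(\hat V)|_x(y,y)>0$ for nonzero $y\in T_x^\perp\mathcal M$, where $T_x^\perp\mathcal M\subset T_x\mathbb R^d$ is the orthogonal complement of $T_x\mathcal M$.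
   Context: Setting: $\Omega\subset\mathbb R^d$ is open and connected, $k>2$ is an integer, $b\in C^k(\Omega;\mathbb R^d)$, $A\in C^{k+1}(\Omega;\mathbf S^d_+)$ with $\mathbf S^d_+$ the set of symmetric positive definite $d\times d$ matrices; $\varphi^t$ is the local flow of $\dot x=b(x)$ in $\Omega$, and $x\cdot t:=\varphi^t(x)$. $\Psi(x,t):=D\varphi^t(x)$. $\subset\subset$ means compactly contained. Normally contracting invariant manifold: a $\varphi^t$-invariant, compact, connected $C^k$ submanifold $\mathcal M\subset\Omega$ of dimension $d_{\mathcal M}<d$ such that there are $C>0$, $0<\beta_0<\beta_*$ with $\frac{\beta_0}{\beta_*-\beta_0}<\frac1{k'}$ for some integer $1\le k'\le k-1$, and subspaces $S(x)$, such that for each $x\in\mathcal M$: $T_x\mathbb R^d=S(x)\oplus T_x\mathcal M$; $\Psi(x,t)S(x)=S(x\cdot t)$ for $t\in\mathbb R$; $\|\Psi(x,t)|_{S(x)}\|\le Ce^{-\beta_*t}$ for $t\ge0$; $\|\Psi(x,t)|_{T_x\mathcal M}\|\le Ce^{\beta_0|t|}$ for $t\in\mathbb R$. Hamiltonian: $H(x,p)=p^\top A(x)p+b(x)\cdot p$. $\Phi_H^t$ is the local flow of the Hamiltonian system $\dot x=2A(x)p+b(x)$, $\dot p=-p^\top\nabla A(x)p-\nabla b^\top(x)p$ in $\Omega\times\mathbb R^d$, where the $i$-th component of $p^\top\nabla A(x)p$ is $p^\top\partial_iA(x)p$. $(X_{x,p}(t),P_{x,p}(t)):=\Phi_H^t(x,p)$.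 For $x\in\mathcal M$, $\Psi_H(x,t)$ is the principal fundamental matrix solution at time $0$ of $\dot y=\nabla b(x\cdot t)y+2A(x\cdot t)q$, $\dot q=-\nabla b^\top(x\cdot t)q$. $P(x)$ is the projection onto $S(x)$ along $T_x\mathcal M$, $E(x):=\mathrm{ran}\,P^\top(x)$, $Q(x):=2\int_{-\infty}^0\Psi(x\cdot s,-s)A(x\cdot s)(\Psi^\top)^{-1}(x,s)P^\top(x)\,ds$ (well-defined, injective on $E(x)$), $Q(x)^{-1}:\mathrm{ran}\,Q(x)\to E(x)$ the inverse of $Q(x)|_{E(x)}$, and $\mathcal E(x,0):=\{(Q(x)q,q):q\in E(x)\}$. Unstable manifold data (existence is a theorem of the paper): a $d$-dimensional $C^{k'}$ Lagrangian submanifold $\mathcal W^u\subset\Omega\times\mathbb R^d$ (for $\sum_i dx^i\wedge dp^i$) with $\Phi_H^t\mathcal W^u\subset\mathcal W^u$ for $t\le0$, open sets $\mathcal M\subset\mathcal O_1\subset\subset\mathcal O_0\subset\subset\Omega$, and $F\in C^{k'}(\mathcal O_0;\mathbb R^d)$, such that: (i) $\mathcal M\times\{0\}\subset\mathcal W^u$ and $T_{(x,0)}\mathcal W^u=\mathcal E(x,0)\oplus T_{(x,0)}(\mathcal M\times\{0\})$ for $x\in\mathcal M$; (ii) $\mathcal W^u$ is the disjoint union of $C^{k'}$ manifolds $\mathcal W^u_x\ni(x,0)$, $x\in\mathcal M$, each diffeomorphic to a ball in $\mathcal E(x,0)$ and tangent to $\mathcal E(x,0)$ at $(x,0)$, with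 $\Phi_H^t\mathcal W^u_x\subset\mathcal W^u_{x\cdot t}$ for $t\le0$; (iii) the map $\pi_{\mathcal W^u}:\mathcal W^u\to\mathcal M$ sending $\mathcal W^u_{\tilde x}$ to $\tilde x$ is $C^{k'}$, and for any $0<\beta<\beta_*$ there is $C>0$ with $\mathrm{dist}(\Phi_H^t(x,p),(\pi_{\mathcal W^u}(x,p)\cdot t,0))\le Ce^{\beta t}$ for $(x,p)\in\mathcal W^u$, $t\le0$; (1') $\mathrm{graph}\,F=\mathcal W^u\cap(\mathcal O_0\times\mathbb R^d)$ and $F=0$ on $\mathcal M$; (2') $\pi(x):=\pi_{\mathcal W^u}(x,F(x))$ is $C^{k'}$ on $\mathcal O_0$ and for any $\beta\in(0,\beta_* )$, $\lim_{t\to-\infty}\sup_{x\in\mathcal O_0}e^{\beta|t|}(|X_{x,F(x)}(t)-\pi(x)\cdot t|+|P_{x,F(x)}(t)|)=0$; (3') $\Phi_H^t(\mathrm{graph}\,F|_{\mathcal O_1})\subset\mathrm{graph}\,F$ for $t\le0$; (4') $H(x,F(x))=0$ on $\mathcal O_0$; (5') for $x\in\mathcal M$, $T_x\mathbb R^d=T_x\mathcal M\oplus\mathrm{ran}\,Q(x)$, $\nabla F(x)y=0$ for $y\in T_x\mathcal M$ and $\nabla F(x)y=Q(x)^{-1}y$ for $y\in\mathrm{ran}\,Q(x)$; (6') for $x\in\mathcal M$, $y_0\in\mathbb R^d$, $\Psi_H(x,t)(y_0,\nabla F(x)y_0)=(y(t),\nabla F(x\cdot t)y(t))$ for $t\le0$,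 $y(t)$ being the first component of the left side. *)

(* Defs.v *)
From mathcomp Require Import all_boot all_order all_algebra.
From mathcomp Require Import all_classical all_reals all_analysis.
Import Order.TTheory GRing.Theory Num.Theory.
Import numFieldNormedType.Exports.

Set Implicit Arguments.
Unset Strict Implicit.
Unset Printing Implicit Defensive.

Local Open Scope classical_set_scope.
Local Open Scope ring_scope.

(* The library norm on ['cV[R]_d] is the sup norm, hence the Euclidean
   norms [enorm] and [enorm2] (on R^d and R^d x R^d). *)
Definition dot {R : realType} {d : nat} (y z : 'cV[R]_d) : R :=
  (y^T *m z) 0 0.

Definition enorm {R : realType} {d : nat} (y : 'cV[R]_d) : R :=
  Num.sqrt (dot y y).

Definition enorm2 {R : realType} {d : nat} (z : 'cV[R]_d * 'cV[R]_d) : R :=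
  Num.sqrt (dot z.1 z.1 + dot z.2 z.2).

Definition bilin {R : realType} {d : nat} (B : 'M[R]_d) (y z : 'cV[R]_d) : R :=
  (y^T *m B *m z) 0 0.

Definition sympos {R : realType} {d : nat} (B : 'M[R]_d) : Prop :=
  B^T = B /\ forall p : 'cV[R]_d, p != 0 -> 0 < bilin B p p.

Definition evec {R : realType} {d : nat} (j : 'I_d) : 'cV[R]_d := delta_mx j 0.

(* [(jac f x) i j] is the j-th partial derivative of the i-th component. *)
Definition jac {R : realType} {d e : nat} (f : 'cV[R]_d -> 'cV[R]_e)
    (x : 'cV[R]_d) : 'M[R]_(e, d) :=
  \matrix_(i < e, j < d) ('D_(evec j) f x) i 0.

Definition grad {R : realType} {d : nat} (f : 'cV[R]_d -> R)
    (x : 'cV[R]_d) : 'cV[R]_d :=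
  \col_(i < d) 'D_(evec i) f x.

Definition hess {R : realType} {d : nat} (f : 'cV[R]_d -> R)
    (x : 'cV[R]_d) : 'M[R]_d := jac (grad f) x.

(* C^k on an open set [O]; use [Ck_on] for other sets. *)
Fixpoint Ck {R : realType} {V W : normedModType R} (k : nat) (O : set V)
    (f : V -> W) : Prop :=
  match k with
  | 0 => forall x, O x -> {for x, continuous f}
  | k'.+1 => (forall x, O x -> differentiable f x) /\
             (forall v, Ck k' O (fun x => 'D_v f x))
  end.

(* C^k on an arbitrary subset: locally the restriction of an ambient
   C^k map. *)
Definition Ck_on {R : realType} {V W : normedModType R} (k : nat) (S : set V)
    (f : V -> W) : Prop :=
  forall x, S x -> exists (U : set V) (g : V -> W),
    [/\ open U, U x, Ck k U g & forall y, (S `&` U) y -> f y = g y].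

Definition Ck_diffeomorphic {R : realType} {V W : normedModType R} (k : nat)
    (B : set V) (S : set W) : Prop :=
  exists (f : V -> W) (g : W -> V),
    [/\ Ck_on k B f, Ck_on k S g, f @` B = S & forall v, B v -> g (f v) = v].

(* [S] is an embedded m-dimensional C^k submanifold of the n-dimensional
   space [V]: slice charts straighten [S] to R^m x {0} in R^n. *)
Definition submanifold {R : realType} {V : normedModType R} (k n m : nat)
    (S : set V) : Prop :=
  (m <= n)%N /\
  forall z, S z ->
  exists (U : set V) (U' : set 'cV[R]_n) (f : V -> 'cV[R]_n) (g : 'cV[R]_n -> V),
    [/\ open U /\ open U',
        U z,
        Ck k U f /\ Ck k U' g,
        [/\ f @` U = U', g @` U' = U, (forall u, U u -> g (f u) = u)
          & (forall y, U' y -> f (g y) = y)]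
      & f @` (S `&` U) =
        U' `&` [set y | forall i : 'I_n, (m <= i)%N -> y i 0 = 0]].

(* Velocities at [z] of curves lying in [S]. *)
Definition tangent {R : realType} {V : normedModType R} (S : set V) (z : V) :
    set V :=
  [set v | exists c : R -> V,
     [/\ c 0 = z, (\forall t \near (0 : R), S (c t)) & is_derive (0 : R) 1 c v]].

Definition direct_sum {R : realType} {V : normedModType R} (E A B : set V) :
    Prop :=
  E = [set u + v | u in A & v in B] /\ A `&` B = [set 0].

Definition compactly_contained {T : topologicalType} (A B : set T) : Prop :=
  compact (closure A) /\ closure A `<=` B.

(* [flow_rel f D t x y]: a solution of z' = f z in [D], defined on an open
   interval containing 0 and t, goes from x at time 0 to y at time t. *)
Definition flow_rel {R : realType} {V : normedModType R} (f : V -> V)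
    (D : set V) (t : R) (x y : V) : Prop :=
  exists (l u : R) (c : R -> V),
    [/\ l < 0 < u, l < t < u, c 0 = x, c t = y &
        forall s, l < s < u -> D (c s) /\ is_derive s 1 c (f (c s))].

Definition flow_dom {R : realType} {V : normedModType R} (f : V -> V)
    (D : set V) (t : R) : set V :=
  [set x | exists y, flow_rel f D t x y].

(* Outside [flow_dom f D t] the value is the irrelevant default 0. *)
Definition flow {R : realType} {V : normedModType R} (f : V -> V)
    (D : set V) (t : R) (x : V) : V :=
  xget 0 [set y | flow_rel f D t x y].

(* Inclusion of the image of [S] in [S'], where the flow is required to be
   defined at time [t] on all of [S]. *)
Definition flow_maps {R : realType} {V : normedModType R} (f : V -> V)
    (D : set V) (t : R) (S S' : set V) : Prop :=
  S `<=` flow_dom f D t /\ flow f D t @` S `<=` S'.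

Definition Psi {R : realType} {d : nat} (Omega : set 'cV[R]_d)
    (b : 'cV[R]_d -> 'cV[R]_d) (x : 'cV[R]_d) (t : R) : 'M[R]_d :=
  jac (flow b Omega t) x.

Definition Ham {R : realType} {d : nat} (b : 'cV[R]_d -> 'cV[R]_d)
    (A : 'cV[R]_d -> 'M[R]_d) (x p : 'cV[R]_d) : R :=
  bilin (A x) p p + dot (b x) p.

Definition Lag {R : realType} {d : nat} (b : 'cV[R]_d -> 'cV[R]_d)
    (A : 'cV[R]_d -> 'M[R]_d) (x v : 'cV[R]_d) : R :=
  4^-1 * bilin (invmx (A x)) (b x - v) (b x - v).

Definition Hfield {R : realType} {d : nat} (b : 'cV[R]_d -> 'cV[R]_d)
    (A : 'cV[R]_d -> 'M[R]_d) (z : 'cV[R]_d * 'cV[R]_d) :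
    'cV[R]_d * 'cV[R]_d :=
  (2 *: (A z.1 *m z.2) + b z.1,
   - (\col_(i < d) bilin ('D_(evec i) A z.1) z.2 z.2) - (jac b z.1)^T *m z.2).

Definition Hdom {R : realType} {d : nat} (Omega : set 'cV[R]_d) :
    set ('cV[R]_d * 'cV[R]_d) := Omega `*` setT.

Definition Hflow {R : realType} {d : nat} (Omega : set 'cV[R]_d)
    (b : 'cV[R]_d -> 'cV[R]_d) (A : 'cV[R]_d -> 'M[R]_d) (t : R)
    (z : 'cV[R]_d * 'cV[R]_d) : 'cV[R]_d * 'cV[R]_d :=
  flow (Hfield b A) (Hdom Omega) t z.

(* Principal fundamental matrix at time 0 of the Hamiltonian system
   linearized along the orbit of (x, 0), for [x] in the invariant manifold. *)
Definition PsiH {R : realType} {d : nat} (Omega : set 'cV[R]_d)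
    (b : 'cV[R]_d -> 'cV[R]_d) (A : 'cV[R]_d -> 'M[R]_d) (x : 'cV[R]_d) :
    R -> 'M[R]_(d + d) :=
  xget (fun=> 0) [set Y : R -> 'M[R]_(d + d) | Y 0 = 1%:M /\
    forall t : R,
      is_derive t 1 Y
        (block_mx (jac b (flow b Omega t x)) (2 *: A (flow b Omega t x))
                  0 (- (jac b (flow b Omega t x))^T) *m Y t)].

Record ncim {R : realType} {d : nat} (k : nat) (Omega : set 'cV[R]_d)
    (b : 'cV[R]_d -> 'cV[R]_d) (M : set 'cV[R]_d) (dM : nat)
    (S : 'cV[R]_d -> {vspace 'cV[R]_d}) (beta0 betas : R) (k' : nat) : Prop :=
  NCIM {
    ncim_sub : M `<=` Omega;
    ncim_dim : (dM < d)%N;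
    ncim_mfd : submanifold k d dM M;
    ncim_compact : compact M;
    ncim_connected : connected M;
    ncim_inv : forall t : R,
      M `<=` flow_dom b Omega t /\ flow b Omega t @` M = M;
    ncim_rates : 0 < beta0 < betas;
    ncim_k' : (1 <= k' <= k.-1)%N;
    ncim_gap : beta0 / (betas - beta0) < k'%:R^-1;
    ncim_split : forall x, M x ->
      direct_sum setT [set` S x] (tangent M x);
    ncim_S_inv : forall x, M x -> forall t : R,
      mulmx (Psi Omega b x t) @` [set` S x] = [set` S (flow b Omega t x)];
    ncim_bounds : exists C : R, [/\ 0 < C,
      (forall x, M x -> forall t : R, 0 <= t -> forall v, v \in S x ->
         enorm (Psi Omega b x t *m v) <= C * expR (- betas * t) * enorm v) &
      (forall x, M x -> forall (t : R) v, tangent M x v ->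
         enorm (Psi Omega b x t *m v) <= C * expR (beta0 * `|t|) * enorm v)]
  }.

Definition projS {R : realType} {d : nat} (M : set 'cV[R]_d)
    (S : 'cV[R]_d -> {vspace 'cV[R]_d}) (x : 'cV[R]_d) : 'M[R]_d :=
  xget 0 [set P : 'M[R]_d |
    (forall v, v \in S x -> P *m v = v) /\
    (forall v, tangent M x v -> P *m v = 0)].

Definition Espace {R : realType} {d : nat} (M : set 'cV[R]_d)
    (S : 'cV[R]_d -> {vspace 'cV[R]_d}) (x : 'cV[R]_d) : set 'cV[R]_d :=
  range (fun q : 'cV[R]_d => (projS M S x)^T *m q).

Definition Qmx {R : realType} {d : nat} (Omega : set 'cV[R]_d)
    (b : 'cV[R]_d -> 'cV[R]_d) (A : 'cV[R]_d -> 'M[R]_d) (M : set 'cV[R]_d)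
    (S : 'cV[R]_d -> {vspace 'cV[R]_d}) (x : 'cV[R]_d) : 'M[R]_d :=
  \matrix_(i < d, j < d) (2 * \int[lebesgue_measure]_(s in `]-oo, (0 : R)])
    (Psi Omega b (flow b Omega s x) (- s) *m A (flow b Omega s x)
       *m invmx (Psi Omega b x s)^T *m (projS M S x)^T) i j).

Definition Qran {R : realType} {d : nat} (Omega : set 'cV[R]_d)
    (b : 'cV[R]_d -> 'cV[R]_d) (A : 'cV[R]_d -> 'M[R]_d) (M : set 'cV[R]_d)
    (S : 'cV[R]_d -> {vspace 'cV[R]_d}) (x : 'cV[R]_d) : set 'cV[R]_d :=
  range (fun q : 'cV[R]_d => Qmx Omega b A M S x *m q).

(* Inverse of the restriction of Q(x) to E(x). *)
Definition Qinv {R : realType} {d : nat} (Omega : set 'cV[R]_d)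
    (b : 'cV[R]_d -> 'cV[R]_d) (A : 'cV[R]_d -> 'M[R]_d) (M : set 'cV[R]_d)
    (S : 'cV[R]_d -> {vspace 'cV[R]_d}) (x y : 'cV[R]_d) : 'cV[R]_d :=
  xget 0 [set q | Espace M S x q /\ Qmx Omega b A M S x *m q = y].

Definition Efiber {R : realType} {d : nat} (Omega : set 'cV[R]_d)
    (b : 'cV[R]_d -> 'cV[R]_d) (A : 'cV[R]_d -> 'M[R]_d) (M : set 'cV[R]_d)
    (S : 'cV[R]_d -> {vspace 'cV[R]_d}) (x : 'cV[R]_d) :
    set ('cV[R]_d * 'cV[R]_d) :=
  [set (Qmx Omega b A M S x *m q, q) | q in Espace M S x].

Definition isotropic {R : realType} {d : nat} (W : set ('cV[R]_d * 'cV[R]_d)) :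
    Prop :=
  forall z, W z -> forall u v, tangent W z u -> tangent W z v ->
    dot u.1 v.2 - dot v.1 u.2 = 0.

Definition graph_on {R : realType} {d : nat} (O : set 'cV[R]_d)
    (F : 'cV[R]_d -> 'cV[R]_d) : set ('cV[R]_d * 'cV[R]_d) :=
  [set (x, F x) | x in O].

(* The base point map of a family of disjoint leaves [Wx x], x in M. *)
Definition leaf_proj {R : realType} {d : nat} (M : set 'cV[R]_d)
    (Wx : 'cV[R]_d -> set ('cV[R]_d * 'cV[R]_d)) (z : 'cV[R]_d * 'cV[R]_d) :
    'cV[R]_d :=
  xget 0 [set x | M x /\ Wx x z].

Record unstable_data {R : realType} {d : nat} (Omega : set 'cV[R]_d)
    (b : 'cV[R]_d -> 'cV[R]_d) (A : 'cV[R]_d -> 'M[R]_d)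
    (M : set 'cV[R]_d) (S : 'cV[R]_d -> {vspace 'cV[R]_d}) (betas : R)
    (k' : nat) (Wu : set ('cV[R]_d * 'cV[R]_d))
    (Wx : 'cV[R]_d -> set ('cV[R]_d * 'cV[R]_d))
    (O0 : set 'cV[R]_d) (F : 'cV[R]_d -> 'cV[R]_d) (O1 : set 'cV[R]_d) : Prop :=
  UnstableData {
    ud_sub : Wu `<=` Hdom Omega;
    ud_mfd : submanifold k' (d + d) d Wu;
    ud_lagr : isotropic Wu;
    ud_inv : forall t : R, t <= 0 -> flow_maps (Hfield b A) (Hdom Omega) t Wu Wu;
    ud_open0 : open O0;
    ud_open1 : open O1;
    ud_M_O1 : M `<=` O1;
    ud_O1_O0 : compactly_contained O1 O0;
    ud_O0_Omega : compactly_contained O0 Omega;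
    ud_F : Ck k' O0 F;
    ud_M_Wu : M `*` [set 0] `<=` Wu;
    ud_tangent : forall x, M x ->
      direct_sum (tangent Wu (x, 0)) (Efiber Omega b A M S x)
                 (tangent (M `*` [set 0]) (x, 0));
    ud_cover : Wu = \bigcup_(x in M) Wx x;
    ud_disjoint : trivIset M Wx;
    ud_leaf_base : forall x, M x -> Wx x (x, 0);
    ud_leaf_mfd : forall x, M x -> exists m, submanifold k' (d + d) m (Wx x);
    ud_leaf_ball : forall x, M x -> exists r : R, 0 < r /\
      Ck_diffeomorphic k'
        (Efiber Omega b A M S x `&` [set z | enorm2 z < r]) (Wx x);
    ud_leaf_tangent : forall x, M x ->
      tangent (Wx x) (x, 0) = Efiber Omega b A M S x;
    ud_leaf_inv : forall x, M x -> forall t : R, t <= 0 ->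
      flow_maps (Hfield b A) (Hdom Omega) t (Wx x) (Wx (flow b Omega t x));
    ud_proj : Ck_on k' Wu (leaf_proj M Wx);
    ud_decay : forall beta : R, 0 < beta < betas -> exists C : R, 0 < C /\
      forall z, Wu z -> forall t : R, t <= 0 ->
        enorm2 (Hflow Omega b A t z - (flow b Omega t (leaf_proj M Wx z), 0))
          <= C * expR (beta * t);
    ud_graph : graph_on O0 F = Wu `&` (O0 `*` setT);
    ud_F0 : forall x, M x -> F x = 0;
    ud_pi : Ck k' O0 (fun x => leaf_proj M Wx (x, F x));
    ud_sup : forall beta : R, 0 < beta < betas ->
      ereal_sup [set (expR (beta * `|t|) *
          (enorm ((Hflow Omega b A t (x, F x)).1
                  - flow b Omega t (leaf_proj M Wx (x, F x)))
           + enorm (Hflow Omega b A t (x, F x)).2))%:E | x in O0]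
        @[t --> -oo_R] --> 0%E;
    ud_graph_inv : forall t : R, t <= 0 ->
      flow_maps (Hfield b A) (Hdom Omega) t (graph_on O1 F) (graph_on O0 F);
    ud_H0 : forall x, O0 x -> Ham b A x (F x) = 0;
    ud_split : forall x, M x ->
      direct_sum setT (tangent M x) (Qran Omega b A M S x);
    ud_dF_tangent : forall x, M x -> forall y, tangent M x y ->
      jac F x *m y = 0;
    ud_dF_Q : forall x, M x -> forall y, Qran Omega b A M S x y ->
      jac F x *m y = Qinv Omega b A M S x y;
    ud_dF_inv : forall x, M x -> forall (y0 : 'cV[R]_d) (t : R), t <= 0 ->
      let w := PsiH Omega b A x t *m col_mx y0 (jac F x *m y0) in
      dsubmx w = jac F (flow b Omega t x) *m usubmx w
  }.

Definition running_cost {R : realType} {d : nat} (Omega : set 'cV[R]_d)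
    (b : 'cV[R]_d -> 'cV[R]_d) (A : 'cV[R]_d -> 'M[R]_d)
    (F : 'cV[R]_d -> 'cV[R]_d) (x : 'cV[R]_d) (t : R) : R :=
  let X := fun s : R => (Hflow Omega b A s (x, F x)).1 in
  Lag b A (X t) (derive1 X t).

Definition Vhat {R : realType} {d : nat} (Omega : set 'cV[R]_d)
    (b : 'cV[R]_d -> 'cV[R]_d) (A : 'cV[R]_d -> 'M[R]_d)
    (F : 'cV[R]_d -> 'cV[R]_d) (x : 'cV[R]_d) : R :=
  \int[lebesgue_measure]_(t in `]-oo, (0 : R)]) running_cost Omega b A F x t.

(* Main.v *)
(** Along a backward orbit [(X, P)] on the graph of [F] the Hamiltonian vanishes,
    so the running cost is [P^T A P = F(X) . X'] and the value is the line
    integral of the 1-form [F] along the orbit.  Since [W^u] is Lagrangian, [F]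
    is closed.  Since [F] vanishes on [M], where the projection [pi] takes its
    values, the integral of [F] over the segment from [pi z] to [z] is a
    primitive of [F] near [M] that vanishes on [M]; hence it equals the cost
    accumulated up to time [t] when [t] is very negative.  The property that the
    cost up to time [t] is, for initial points near [x], a primitive of [F]
    evaluated at [X(t)] then propagates to [t = 0] through local primitives of
    [F]; only continuity of the flow in the initial point is needed, not its
    derivative.  This gives [grad V = F].

    If [V x = 0] then [F] vanishes along the orbit.  As the kernel of [DF] on
    [M] is the tangent space, the zeros of [F] near [M] lie in [M], so the orbit
    of [x] meets [M] and [x] is in [M] by invariance.  The Hessian on [M] is
    [DF]: it is positive semi-definite because [M] consists of minima of [V],
    and its kernel is the tangent space. *)
From HB Require Import structures.
Require Import Defs.
From mathcomp Require Import all_boot all_order all_algebra.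
From mathcomp Require Import all_classical all_reals all_analysis.
From mathcomp Require Import ring lra.
Import Order.TTheory GRing.Theory Num.Theory.
Import numFieldNormedType.Exports.

Set Implicit Arguments.
Unset Strict Implicit.
Unset Printing Implicit Defensive.

Local Open Scope classical_set_scope.
Local Open Scope ring_scope.

(** * Matrix norms and the dot product *)

(** Differentiating the cost under the integral sign would require the derivative of the flow in the
    initial point and its decay as time tends to minus infinity. The argument by primitives replaces
    this by two uniform facts: one time [T] before which every orbit issued from [O1] is close to
    [M], and closeness on [[T, 0]] of orbits with nearby starts. The second is Gronwall's inequality
    with a single Lipschitz constant, available because backward orbits on the graph stay in a fixed
    compact set. The segments start at [pi z], not at a fixed point of [M], so that one formula
    gives a primitive vanishing on [M] near every point of [M]; an orbit that keeps drifting along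
    [M] then needs no change of primitive. The real integral in [Vhat] has a default value when the
    extended integral is infinite. Finiteness is therefore obtained together with the gradient, from
    identities between extended reals. *)

Lemma ler_coord_norm (R : realType) m n (x : 'M[R]_(m, n)) i j :
  `|x i j| <= `|x|.
Proof.
rewrite [leRHS]/Num.Def.normr/= mx_normrE.
exact: (le_bigmax _ (fun ij : 'I_m * 'I_n => `|x ij.1 ij.2|) (i, j)).
Qed.

Lemma mx_norm_le (R : realType) m n (x : 'M[R]_(m, n)) (e : R) :
  0 <= e -> (forall i j, `|x i j| <= e) -> `|x| <= e.
Proof.
move=> e0 xe; rewrite [leLHS]/Num.Def.normr/= mx_normrE.
by apply: (bigmax_le _ e0) => -[i j] _; exact: xe.
Qed.

Lemma norm_mulmx_le (R : realType) m n p (A : 'M[R]_(m, n)) (B : 'M[R]_(n, p)) :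
  `|A *m B| <= n%:R * `|A| * `|B|.
Proof.
apply: mx_norm_le => [|i j]; first by rewrite !mulr_ge0.
rewrite mxE; apply: le_trans (ler_norm_sum _ _ _) _.
apply: (@le_trans _ _ (\sum_(k < n) `|A| * `|B|)).
  by apply: ler_sum => k _; rewrite normrM ler_pM// ler_coord_norm.
by rewrite sumr_const card_ord -mulrA mulr_natl.
Qed.

Lemma norm_trmx (R : realType) m n (A : 'M[R]_(m, n)) : `|A^T| = `|A|.
Proof.
apply/eqP; rewrite eq_le; apply/andP; split; apply: mx_norm_le => // i j.
  by rewrite mxE ler_coord_norm.
by have := ler_coord_norm A^T j i; rewrite mxE.
Qed.

Lemma dotE (R : realType) d (y z : 'cV[R]_d) :
  dot y z = \sum_(i < d) y i 0 * z i 0.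
Proof. by rewrite /dot mxE; apply: eq_bigr => i _; rewrite mxE. Qed.

Lemma dotC (R : realType) d (y z : 'cV[R]_d) : dot y z = dot z y.
Proof. by rewrite !dotE; apply: eq_bigr => i _; rewrite mulrC. Qed.

Lemma dotDr (R : realType) d (x y z : 'cV[R]_d) :
  dot x (y + z) = dot x y + dot x z.
Proof. by rewrite /dot mulmxDr mxE. Qed.

Lemma dotZr (R : realType) d (a : R) (x y : 'cV[R]_d) :
  dot x (a *: y) = a * dot x y.
Proof. by rewrite /dot -scalemxAr mxE. Qed.

Lemma dotNr (R : realType) d (x y : 'cV[R]_d) : dot x (- y) = - dot x y.
Proof. by rewrite /dot mulmxN mxE. Qed.

Lemma dotDl (R : realType) d (x y z : 'cV[R]_d) :
  dot (x + y) z = dot x z + dot y z.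
Proof. by rewrite dotC dotDr !(dotC z). Qed.

Lemma dotZl (R : realType) d (a : R) (x y : 'cV[R]_d) :
  dot (a *: x) y = a * dot x y.
Proof. by rewrite dotC dotZr dotC. Qed.

Lemma dotNl (R : realType) d (x y : 'cV[R]_d) : dot (- x) y = - dot x y.
Proof. by rewrite dotC dotNr dotC. Qed.

Lemma dot0l (R : realType) d (x : 'cV[R]_d) : dot 0 x = 0.
Proof. by rewrite /dot trmx0 mul0mx mxE. Qed.

Lemma dot0r (R : realType) d (x : 'cV[R]_d) : dot x 0 = 0.
Proof. by rewrite dotC dot0l. Qed.

Lemma dot_trmxl (R : realType) d e (B : 'M[R]_(e, d)) x y :
  dot (B *m x) y = dot x (B^T *m y).
Proof. by rewrite /dot trmx_mul mulmxA. Qed.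

Lemma bilinE (R : realType) d (B : 'M[R]_d) y z : bilin B y z = dot y (B *m z).
Proof. by rewrite /bilin /dot mulmxA. Qed.

Lemma norm_dot_le (R : realType) d (y z : 'cV[R]_d) :
  `|dot y z| <= d%:R * `|y| * `|z|.
Proof.
apply: le_trans (ler_coord_norm _ _ _) _.
by apply: le_trans (norm_mulmx_le _ _) _; rewrite norm_trmx.
Qed.

Lemma dot_ge0 (R : realType) d (y : 'cV[R]_d) : 0 <= dot y y.
Proof. by rewrite dotE sumr_ge0// => i _; rewrite -expr2 sqr_ge0. Qed.

Lemma sqr_norm_le_dot (R : realType) d (y : 'cV[R]_d) : `|y| ^+ 2 <= dot y y.
Proof.
rewrite -[leRHS]sqr_sqrtr ?dot_ge0// ler_pXn2r ?nnegrE ?sqrtr_ge0//.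
apply: mx_norm_le; first exact: sqrtr_ge0.
move=> i j; rewrite -(@ler_pXn2r _ 2%N) ?nnegrE ?sqrtr_ge0//.
rewrite sqr_sqrtr ?dot_ge0// dotE (bigD1 i)//= real_normK ?num_real//.
rewrite ord1 expr2 lerDl sumr_ge0// => k _.
by rewrite -expr2 sqr_ge0.
Qed.

Lemma dot_eq0 (R : realType) d (y : 'cV[R]_d) : dot y y = 0 -> y = 0.
Proof.
move=> y0; have := sqr_norm_le_dot y; rewrite y0 => y2.
apply/eqP; rewrite -normr_eq0 -sqrf_eq0.
by rewrite eq_le y2 sqr_ge0.
Qed.

(** Transfers the Euclidean decay estimates to the max norm, in which neighbourhoods and continuity
    are expressed. *)
Lemma norm_le_enorm2 (R : realType) d (z : 'cV[R]_d * 'cV[R]_d) :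
  `|z| <= enorm2 z.
Proof.
have q0 : 0 <= dot z.1 z.1 + dot z.2 z.2 by rewrite addr_ge0 ?dot_ge0.
rewrite [leLHS]/Num.Def.normr/= ge_max; apply/andP; split;
  rewrite -(@ler_pXn2r _ 2%N) ?nnegrE ?sqrtr_ge0// sqr_sqrtr//.
  by apply: le_trans (sqr_norm_le_dot _) _; rewrite lerDl dot_ge0.
by apply: le_trans (sqr_norm_le_dot _) _; rewrite lerDr dot_ge0.
Qed.

Lemma trmx_cts (R : realType) m n : continuous (@trmx R m n).
Proof.
apply/linear_bounded_continuous/bounded_funP => r; exists r => A.
by rewrite norm_trmx.
Qed.

Lemma bounded_closed_compact_cV (R : realType) d (K : set 'cV[R]_d) (C : R) :
  closed K -> (forall z, K z -> `|z| <= C) -> compact K.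
Proof.
move=> cK KC.
have -> : K = trmx @` [set u : 'rV[R]_d | K u^T].
  apply/seteqP; split => [z Kz|_ [u Ku <-]//].
  by exists z^T; rewrite /= ?trmxK.
apply: continuous_compact; first exact/continuous_subspaceT/trmx_cts.
apply: bounded_closed_compact.
  exists C; split; first exact: num_real.
  move=> x Cx u /= Ku; rewrite -norm_trmx.
  by apply: le_trans (KC _ Ku) (ltW Cx).
exact: (closed_comp (fun x _ => @trmx_cts _ _ _ x)).
Qed.

Lemma dist_cts (R : realType) (V : normedModType R) (c : V) :
  continuous (fun z : V => `|z - c|).
Proof.
by move=> z; apply: cvg_norm; apply: cvgB; [exact: cvg_id|exact: cvg_cst].
Qed.

Lemma open_dist_lt (R : realType) (V : normedModType R) (c : V) (r : R) :
  open [set y | `|y - c| < r].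
Proof.
apply: (@open_comp _ _ (fun y => `|y - c|) [set x | x < r]); last exact:
  open_lt.
by move=> y _; exact: dist_cts.
Qed.

Lemma compact_ball_le (R : realType) d (c : 'cV[R]_d) (r : R) :
  compact [set z | `|z - c| <= r].
Proof.
apply: (@bounded_closed_compact_cV _ _ _ (r + `|c|)); last first.
  move=> z /= zr; rewrite -[z](subrK c).
  by apply: le_trans (ler_normD _ _) _; rewrite lerD2r.
apply: (@closed_comp _ _ (fun z : 'cV[R]_d => `|z - c|) [set x | x <= r]).
  by move=> z _; exact: dist_cts.
exact: closed_le.
Qed.

Lemma dist_segment_lt (R : realType) (V : normedModType R) (c x v : V) (r t :
  R) :
  `|x - c| < r -> `|x + v - c| < r -> 0 <= t <= 1 -> `|x + t *: v - c| < r.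
Proof.
move=> xr yr /andP[t0 t1].
have -> : x + t *: v - c = (1 - t) *: (x - c) + t *: (x + v - c).
  rewrite (addrAC x v) (addrAC x (t *: v)); move: (x - c) => w.
  by rewrite [t *: (w + v)]scalerDr addrA -scalerDl subrK scale1r.
apply: le_lt_trans (ler_normD _ _) _; rewrite !normrZ (ger0_norm t0) ger0_norm
  ?subr_ge0//.
(* Strictness comes from the summand with coefficient [t], so [t = 0] is treated apart. *)
have [->|tn0] := eqVneq t 0; first by rewrite subr0 mul1r mul0r addr0.
have tp : 0 < t by rewrite lt_neqAle eq_sym tn0.
apply: (@lt_le_trans _ _ ((1 - t) * r + t * r)); last by rewrite -mulrDl subrK
  mul1r.
by apply: ler_ltD; [rewrite ler_wpM2l ?subr_ge0// ltW|rewrite ltr_pM2l].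
Qed.

(** * Differential calculus *)

Lemma nbhs_distP (R : realType) (V : normedModType R) (x : V) (P : V -> Prop) :
  (\forall y \near x, P y) <->
  exists2 r : R, 0 < r & forall y, `|y - x| < r -> P y.
Proof.
split=> [/nbhs_ballP[r /= r0 rP]|[r r0 rP]].
  by exists r => // y yx; apply: rP; rewrite -ball_normE /= distrC.
by apply/nbhs_ballP; exists r => //= y; rewrite -ball_normE /= distrC; exact:
  rP.
Qed.

Lemma is_derive_diff (R : realType) (V W : normedModType R) (f df : V -> W) x v
  :
  is_diff x f df -> is_derive x v f (df v).
Proof.
by move=> [fx fE]; split; [exact: diff_derivable|rewrite deriveE// fE].
Qed.

Lemma is_derive_comp_diff (R : realType) (V W : normedModType R)
    (f df : V -> W) (c : R -> V) (t : R) (c' : V) :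
  is_derive t 1 c c' -> is_diff (c t) f df -> is_derive t 1 (f \o c) (df c').
Proof.
move=> [ct cE] fct.
have dct : differentiable c t by apply/derivable1_diffP.
have cd : is_diff t c ('d c t) by exact: differentiableP.
have := is_derive_diff (1 : R) (is_diff_comp cd fct).
by rewrite /= -cE deriveE.
Qed.

Lemma is_derive_line (R : realType) (V : normedModType R) (x v : V) (t : R) :
  is_derive t 1 (fun s : R => x + s *: v) v.
Proof.
have := is_derive_diff (1 : R) (is_diffD (is_diff_cst x t) (is_diff_scalel t
  v)).
by rewrite !fctE add0r scale1r.
Qed.

Lemma is_derive_along (R : realType) (V W : normedModType R) (f : V -> W)
    (x v : V) (t : R) :
  differentiable f (x + t *: v) ->
  is_derive t 1 (fun s : R => f (x + s *: v)) ('D_v f (x + t *: v)).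
Proof.
move=> fd; rewrite deriveE//.
exact: (is_derive_comp_diff (is_derive_line x v t) (differentiableP fd)).
Qed.

Lemma mvt_line (R : realType) (V : normedModType R) (f : V -> R) (x v : V) :
  (forall t : R, 0 <= t <= 1 -> differentiable f (x + t *: v)) ->
  exists2 t : R, 0 <= t <= 1 & f (x + v) - f x = 'D_v f (x + t *: v).
Proof.
move=> fd.
have D (t : R) : 0 <= t <= 1 ->
    is_derive t 1 (fun s : R => f (x + s *: v)) ('D_v f (x + t *: v)).
  by move=> /fd; exact: is_derive_along.
have [||t t01 E] := @MVT_segment R (fun s => f (x + s *: v))
  (fun t => 'D_v f (x + t *: v)) 0 1 ler01.
- by move=> t; rewrite in_itv/= => /andP[t0 t1]; apply: D; rewrite !ltW.
- apply: derivable_within_continuous => t; rewrite in_itv/= => t01.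
  by have [] := D _ t01.
exists t; first by move: t01; rewrite in_itv.
by move: E; rewrite scale1r scale0r addr0 subr0 mulr1.
Qed.

Lemma derive_coord (R : realType) (V : normedModType R) m n
    (f : V -> 'M[R]_(m, n)) x v i j :
  derivable f x v -> 'D_v (fun y => f y i j) x = 'D_v f x i j.
Proof. by move=> fx; rewrite (derive_mx fx) mxE. Qed.

Lemma differentiable_entry (R : realType) (V : normedModType R) m n
    (f : V -> 'M[R]_(m, n)) x i j :
  differentiable f x -> differentiable (fun y => f y i j) x.
Proof.
by move=> fx; exact: (differentiable_comp fx (differentiable_coord _ i j)).
Qed.

Lemma cV_sum_evec (R : realType) d (v : 'cV[R]_d) :
  v = \sum_(i < d) v i 0 *: evec i.
Proof.
apply/colP => k; rewrite summxE (bigD1 k)//= big1 ?addr0; last first.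
  by move=> i ik; rewrite !mxE eqxx andbT eq_sym (negbTE ik) mulr0.
by rewrite !mxE !eqxx mulr1.
Qed.

Lemma derive_sum_evec (R : realType) d (W : normedModType R)
    (f : 'cV[R]_d -> W) x v : differentiable f x ->
  'D_v f x = \sum_(i < d) v i 0 *: 'D_(evec i) f x.
Proof.
move=> fx; rewrite deriveE// {1}(cV_sum_evec v) linear_sum.
by apply: eq_bigr => i _; rewrite linearZ deriveE.
Qed.

Lemma derive_jac (R : realType) d e (f : 'cV[R]_d -> 'cV[R]_e) x v :
  differentiable f x -> 'D_v f x = jac f x *m v.
Proof.
move=> fx; rewrite derive_sum_evec//; apply/colP => i.
rewrite summxE mxE; apply: eq_bigr => k _.
by rewrite !mxE mulrC.
Qed.

Lemma is_diffP_eps (R : realType) (V W : normedModType R) (f : V -> W)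
    (L : {linear V -> W}) x :
  continuous L ->
  (forall e : R, 0 < e ->
     \forall h \near 0, `|f (h + x) - f x - L h| <= e * `|h|) ->
  is_diff x f L.
Proof.
move=> cL H.
have E : f \o shift x = cst (f x) + L +o_ 0 id.
  apply/eqaddoP => e e0; near=> h.
  rewrite !fctE/= opprD addrA.
  by near: h; exact: H.
have D := diff_unique cL E.
by split => //; apply/diff_locallyP; rewrite D; split.
Unshelve. all: by end_near. Qed.

(** Strict differentiability: both points move while the derivative stays at [x0]. Continuity of the
    partial derivatives bounds the error through the mean value theorem on the segment from [y] to
    [x]. *)
Lemma C1_strict (R : realType) d m n (f : 'cV[R]_d -> 'M[R]_(m, n))
    (O : set 'cV[R]_d) x0 (e : R) :
  open O -> Ck 1 O f -> O x0 -> 0 < e ->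
  exists2 r : R, 0 < r & forall x y, `|x - x0| < r -> `|y - x0| < r ->
    `|f x - f y - 'D_(x - y) f x0| <= e * `|x - y|.
Proof.
move=> oO [fO DfO] Ox0 e0.
(* The [d] coordinate directions each contribute this share; [d.+1] keeps the quotient meaningful
   for [d = 0]. *)
have e1 : 0 < e / d.+1%:R by rewrite divr_gt0.
have /nbhs_distP[r r0 rP] : \forall x \near x0, O x /\
    forall k, `|'D_(evec k) f x - 'D_(evec k) f x0| <= e / d.+1%:R.
  near=> x; split; first by near: x; exact: open_nbhs_nbhs.
  near: x; apply: filter_forall => k.
  have := DfO (evec k) _ Ox0; rewrite /continuous_at.
  by move/(@cvgr_distC_le _ _ _ _ _ _ _); exact.
exists r => // x y xr yr.
have seg (t : R) : 0 <= t <= 1 -> `|y + t *: (x - y) - x0| < r.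
  by apply: dist_segment_lt => //; rewrite [y + _]addrC subrK.
apply: mx_norm_le => [|i j]; first by rewrite mulr_ge0// ltW.
have fd (t : R) : 0 <= t <= 1 -> differentiable f (y + t *: (x - y)).
  by move=> /seg/rP[] /fO.
(* The intermediate point depends on the entry, hence one mean value theorem per entry. *)
have [t t01] := @mvt_line R _ (fun z => f z i j) y (x - y)
  (fun t t01 => differentiable_entry i j (fd t t01)).
rewrite [y + (x - y)]addrC subrK => E.
have -> : (f x - f y - 'D_(x - y) f x0) i j = f x i j - f y i j - 'D_(x - y) f
  x0 i j.
  by rewrite mxE [X in X + _]mxE [X in _ + X + _]mxE [X in _ + X]mxE.
rewrite {}E derive_coord; last exact/diff_derivable/fd.
have [_ zP] := rP _ (seg _ t01).
rewrite (derive_sum_evec _ (fO _ Ox0)) (derive_sum_evec _ (fd _ t01)).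
rewrite !summxE -sumrB; apply: le_trans (ler_norm_sum _ _ _) _.
apply: (@le_trans _ _ (\sum_(k < d) `|x - y| * (e / d.+1%:R))).
  apply: ler_sum => k _.
  have -> (a : R) (B C : 'M[R]_(m, n)) :
      (a *: B) i j - (a *: C) i j = a * (B - C) i j by rewrite !mxE mulrBr.
  rewrite normrM ler_pM//; first exact: ler_coord_norm.
  apply: le_trans (zP k).
  exact: ler_coord_norm.
rewrite sumr_const card_ord -mulrnAr mulrC ler_wpM2r// -mulr_natr -mulrA.
by rewrite ler_piMr ?(ltW e0)// ler_pdivrMl// mulr1 ler_nat.
Unshelve. all: by end_near. Qed.

(** Both derivatives are limits of the same difference quotient. With [V = R] and [v = 1] this is
    the rule for a time shift. *)
Lemma is_derive_line_gateaux (R : realType) (V W : normedModType R) (G : V -> W)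
    (x v : V) (t : R) a :
  is_derive (x + t *: v) v G a -> is_derive t 1 (fun s : R => G (x + s *: v)) a.
Proof.
have E : (fun h : R => h^-1 *: (((fun s : R => G (x + s *: v)) \o shift t) (h
  *: 1)
    - G (x + t *: v))) =
    fun h : R => h^-1 *: ((G \o shift (x + t *: v)) (h *: v) - G (x + t *: v)).
  apply/funext => h /=; congr (_ *: (G _ - _)).
  by rewrite scalerDl [h *: 1]mulr1 addrCA.
by move=> [dG GE]; split; [rewrite /derivable E|rewrite /derive E].
Qed.

(** The mean value theorem on the segment from [z] to [z + h] turns the error into
    [dot (F y - F z) h] for some [y] on it, which continuity of [F] at [z] makes small. Directional
    derivatives thus suffice for a Fréchet derivative. *)
Lemma gateaux_grad (R : realType) d (G : 'cV[R]_d -> R) F (O : set 'cV[R]_d) z :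
  open O -> O z ->
  (forall y v, O y -> is_derive y v G (dot (F y) v)) ->
  {for z, continuous F} -> is_diff z G (dot (F z)).
Proof.
move=> oO Oz dG cF.
have lin_dot : linear (dot (F z)) by move=> a u v; rewrite dotDr dotZr.
pose dotM := GRing.isLinear.Build _ _ _ _ _ lin_dot.
pose L : {linear 'cV[R]_d -> R} := HB.pack (dot (F z)) dotM.
rewrite -[dot (F z)]/(L : _ -> _).
apply: is_diffP_eps => [|e e0].
  apply/linear_bounded_continuous/bounded_funP => r.
  exists (d%:R * `|F z| * r) => v vr.
  by apply: le_trans (norm_dot_le _ _) _; rewrite ler_wpM2l.
have e1 : 0 < e / d.+1%:R by rewrite divr_gt0.
have /nbhs_distP[r r0 rP] : \forall y \near z, O y /\ `|F y - F z| <= e /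
  d.+1%:R.
  near=> y; split; first by near: y; exact: open_nbhs_nbhs.
  by near: y; move: cF; rewrite /continuous_at => /(@cvgr_distC_le _ _ _ _ _ _
    _); exact.
apply/nbhs_distP; exists r => // h; rewrite subr0 => hr.
have seg (t : R) : 0 <= t <= 1 -> `|z + t *: h - z| < r.
  by apply: dist_segment_lt; rewrite ?subrr ?normr0// addrC addKr.
have D (t : R) : 0 <= t <= 1 ->
    is_derive t 1 (fun s : R => G (z + s *: h)) (dot (F (z + t *: h)) h).
  by move=> /seg/rP[Oy _]; exact/is_derive_line_gateaux/dG.
have [||t t01] := @MVT_segment R (fun s => G (z + s *: h))
  (fun t => dot (F (z + t *: h)) h) 0 1 ler01.
- by move=> t; rewrite in_itv/= => /andP[t0 t1]; apply: D; rewrite !ltW.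
- apply: derivable_within_continuous => t; rewrite in_itv/= => t01.
  by have [] := D _ t01.
rewrite in_itv/= in t01.
rewrite scale1r scale0r addr0 subr0 mulr1 [h + z]addrC => ->.
rewrite -dotNl -dotDl; apply: le_trans (norm_dot_le _ _) _.
rewrite ler_wpM2r//; apply: (@le_trans _ _ (d%:R * (e / d.+1%:R))).
  by rewrite ler_wpM2l//; have [] := rP _ (seg _ t01).
by rewrite mulrC -mulrA ler_piMr ?(ltW e0)// ler_pdivrMl// mulr1 ler_nat.
Unshelve. all: by end_near. Qed.

(** * Calculus of C^k maps *)

Lemma Ck_sub (R : realType) (V W : normedModType R) k (O O' : set V) (f : V ->
  W) :
  O' `<=` O -> Ck k O f -> Ck k O' f.
Proof.
move=> sO; elim: k f => [|k IH] f /=; first by move=> H x /sO; exact: H.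
by move=> [H1 H2]; split => [x /sO|v]; [exact: H1|exact: IH].
Qed.

Lemma Ck_pred (R : realType) (V W : normedModType R) k (O : set V) (f : V -> W)
  :
  Ck k.+1 O f -> Ck k O f.
Proof.
elim: k f => [|k IH] f.
  by move=> [H _] x Ox; apply: differentiable_continuous; exact: H.
by move=> [H1 H2]; split=> // v; apply: IH.
Qed.

Lemma Ck_le (R : realType) (V W : normedModType R) j k (O : set V) (f : V -> W)
  :
  (j <= k)%N -> Ck k O f -> Ck j O f.
Proof.
move=> /subnKC <-; elim: (k - j)%N => [|i IH]; first by rewrite addn0.
by rewrite addnS => /Ck_pred.
Qed.

Lemma near_eq_is_diff (R : realType) (V W : normedModType R)
    (f g df : V -> W) x :
  (\forall y \near x, f y = g y) -> is_diff x f df -> is_diff x g df.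
Proof.
move=> fg [fx <-]; apply: is_diffP_eps => [|e e0]; first exact: diff_continuous.
have /eqaddoP/(_ _ e0) := diff_locally fx.
rewrite !fctE/= => H.
have {}fg : \forall h \near (0 : V), f (h + x) = g (h + x).
  move/nbhs_distP : fg => [r r0 rP]; apply/nbhs_distP; exists r => // h.
  by rewrite subr0 => hr; apply: rP; rewrite addrK.
near=> h.
have <- : f (h + x) = g (h + x) by near: h.
have := nbhs_singleton fg; rewrite add0r => <-.
by rewrite -addrA -opprD; near: h.
Unshelve. all: by end_near. Qed.

Lemma near_eq_differentiable (R : realType) (V W : normedModType R)
    (f g : V -> W) x :
  (\forall y \near x, f y = g y) -> differentiable f x -> differentiable g x.
Proof. by move=> fg /differentiableP /(near_eq_is_diff fg)[]. Qed.

Lemma Ck_eq (R : realType) (V W : normedModType R) k (O : set V) (f g : V -> W)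
  :
  open O -> (forall x, O x -> f x = g x) -> Ck k O f -> Ck k O g.
Proof.
move=> oO; have nO x : O x -> \forall y \near x, O y.
  by move=> Ox; exact: open_nbhs_nbhs.
elim: k f g => [|k IH] f g fg /=.
  move=> H x Ox; have := H x Ox.
  rewrite /prop_for /continuous_at -fg//; apply: cvg_trans.
  by apply: near_eq_cvg; apply: filterS (nO _ Ox) => y /fg.
move=> [H1 H2]; split=> [x Ox|v].
  apply: near_eq_differentiable (H1 _ Ox).
  by apply: filterS (nO _ Ox) => y /fg.
apply: IH (H2 v) => x Ox; apply: near_eq_derive.
by apply: filterS (nO _ Ox) => y /fg.
Qed.

Lemma Ck_linear (R : realType) (V W W' : normedModType R) k (O : set V)
    (f : V -> W) (L : {linear W -> W'}) :
  open O -> continuous L -> Ck k O f -> Ck k O (L \o f).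
Proof.
move=> oO cL; elim: k f => [|k IH] f /=.
  by move=> H x Ox; apply: continuous_comp; [exact: H|exact: cL].
move=> [H1 H2]; split=> [x Ox|v].
  by apply: differentiable_comp; [exact: H1|exact: linear_differentiable].
apply: Ck_eq (IH _ (H2 v)) => // x Ox /=.
have dL := linear_differentiable (f x) cL.
rewrite [RHS]deriveE; last by apply: differentiable_comp => //; exact: H1.
by rewrite diff_comp//= ?diff_lin// -?deriveE//; exact: H1.
Qed.

Lemma norm_fst_le (R : realType) (V W : normedModType R) (z : V * W) : `|z.1|
  <= `|z|.
Proof. by rewrite [leRHS]/Num.Def.normr/= le_max lexx. Qed.

Lemma norm_snd_le (R : realType) (V W : normedModType R) (z : V * W) : `|z.2|
  <= `|z|.
Proof. by rewrite [leRHS]/Num.Def.normr/= le_max lexx orbT. Qed.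

(** * Local Lipschitz maps and uniqueness of solutions *)

Lemma nbhs_pairP (R : realType) (V W : normedModType R) (x0 : V) (y0 : W)
    (P : V * W -> Prop) :
  (\forall z \near (x0, y0), P z) <->
  exists2 r : R, 0 < r &
    forall x y, `|x - x0| < r -> `|y - y0| < r -> P (x, y).
Proof.
split=> [/nbhs_distP[r r0 rP]|[r r0 rP]].
  exists r => // x y xr yr; apply: rP.
  by rewrite [ltLHS]/Num.Def.normr/= gt_max xr yr.
apply/nbhs_distP; exists r => // -[x y].
by rewrite [ltLHS]/Num.Def.normr/= gt_max => /andP[]; exact: rP.
Qed.

Lemma cts_distP (R : realType) (V W : normedModType R) (f : V -> W) x (e : R) :
  {for x, continuous f} -> 0 < e ->
  exists2 r : R, 0 < r & forall y, `|y - x| < r -> `|f y - f x| < e.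
Proof.
move=> cf e0; apply/(nbhs_distP x (fun y => `|f y - f x| < e)).
exact: (@cvgr_distC_lt _ _ _ (nbhs x) (nbhs_filter x) f (f x) cf e e0).
Qed.

(** The neighbourhood of [(x0, x0)] makes the bound an eventuality in both points at once. [K]
    carries no sign, hence [|K|] in later estimates. *)
Definition loclip (R : realType) (V W : normedModType R) (f : V -> W) (x0 : V)
  :=
  exists K : R, \forall z \near (x0, x0), `|f z.1 - f z.2| <= K * `|z.1 - z.2|.

Lemma C1_loclip (R : realType) d m n (f : 'cV[R]_d -> 'M[R]_(m, n))
    (O : set 'cV[R]_d) x0 : open O -> Ck 1 O f -> O x0 -> loclip f x0.
Proof.
move=> oO fC Ox0; have [r r0 rP] := C1_strict oO fC Ox0 ltr01.
have fd : differentiable f x0 by case: fC => + _; exact.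
have [k k0 kP] := linear_lipschitz (diff_continuous fd).
exists (1 + k); apply/nbhs_pairP; exists r => // x y xr yr /=.
rewrite -[f x - f y](subrK ('D_(x - y) f x0)).
apply: le_trans (ler_normD _ _) _; rewrite mulrDl.
by apply: lerD; [exact: rP|rewrite deriveE].
Qed.

Lemma loclip_cts (R : realType) (V W : normedModType R) (f : V -> W) x0 :
  loclip f x0 -> {for x0, continuous f}.
Proof.
move=> [K /nbhs_pairP[r r0 rP]].
apply/cvgrPdist_le => e e0; apply/nbhs_distP.
exists (Num.min r (e / (`|K| + 1))).
  by rewrite lt_min r0 divr_gt0// ltr_wpDl.
move=> y; rewrite lt_min => /andP[yr ye].
rewrite distrC; apply: le_trans (rP y x0 yr _) _ => /=; first by rewrite subrr
  normr0.
apply: (@le_trans _ _ ((`|K| + 1) * `|y - x0|)).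
  by rewrite ler_wpM2r// (le_trans (ler_norm K))// lerDl.
by rewrite mulrC -ler_pdivlMr ?ltW// ltr_wpDl.
Qed.

Lemma loclip_cst (R : realType) (V W : normedModType R) (a : W) x0 :
  loclip (fun _ : V => a) x0.
Proof.
by exists 0; apply/nbhs_pairP; exists 1 => // x y _ _; rewrite subrr normr0
  mul0r.
Qed.

Lemma loclipD (R : realType) (V W : normedModType R) (f g : V -> W) x0 :
  loclip f x0 -> loclip g x0 -> loclip (fun x => f x + g x) x0.
Proof.
move=> [K KP] [L LP]; exists (K + L); near=> z.
rewrite opprD addrACA mulrDl; apply: le_trans (ler_normD _ _) _.
by apply: lerD; near: z.
Unshelve. all: by end_near. Qed.

Lemma loclipM (R : realType) (V : normedModType R) (f g : V -> R) x0 :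
  loclip f x0 -> loclip g x0 -> loclip (fun x => f x * g x) x0.
Proof.
move=> lf lg; have cf := loclip_cts lf; have cg := loclip_cts lg.
case: lf lg => K KP [L LP].
exists (K * (`|g x0| + 1) + (`|f x0| + 1) * L).
have bd (h : V -> R) : {for x0, continuous h} ->
    \forall x \near x0, `|h x| <= `|h x0| + 1.
  move=> ch; have := @cvgr_dist_le _ _ _ (nbhs x0) _ h (h x0) ch 1 ltr01.
  move/(_ (nbhs_filter x0)); apply: filterS => x; rewrite distrC => hx.
  rewrite -[h x](subrK (h x0)) addrC [leRHS]addrC.
  by rewrite addrC; apply: le_trans (ler_normD _ _) _; rewrite lerD2r.
have /nbhs_pairP[r1 r10 r1P] := KP; have /nbhs_pairP[r2 r20 r2P] := LP.
have /nbhs_distP[r3 r30 r3P] := bd _ cf; have /nbhs_distP[r4 r40 r4P] := bd _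
  cg.
apply/nbhs_pairP; exists (Num.min (Num.min r1 r2) (Num.min r3 r4)).
  by rewrite !lt_min r10 r20 r30 r40.
move=> x y; rewrite !lt_min => /andP[/andP[x1 x2] /andP[x3 x4]].
move=> /andP[/andP[y1 y2] /andP[y3 y4]] /=.
have -> : f x * g x - f y * g y = (f x - f y) * g x + f y * (g x - g y) by ring.
apply: le_trans (ler_normD _ _) _; rewrite !normrM mulrDl.
apply: lerD.
  by rewrite mulrAC; apply: ler_pM => //; [exact: (r1P x y)|exact: r4P].
by rewrite -mulrA; apply: ler_pM => //; [exact: r3P|exact: (r2P x y)].
Qed.

Lemma loclip_sum (R : realType) (V W : normedModType R) (I : Type) (s : seq I)
    (f : I -> V -> W) x0 :
  (forall i, loclip (f i) x0) -> loclip (fun x => \sum_(i <- s) f i x) x0.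
Proof.
move=> H; elim: s => [|i s IH].
  have -> : (fun x => \sum_(i <- [::]) f i x) = (fun=> 0).
    by apply/funext => x; rewrite big_nil.
  exact: loclip_cst.
have -> : (fun x => \sum_(i <- i :: s) f i x) = (fun x => f i x + \sum_(i <- s)
  f i x).
  by apply/funext => x; rewrite big_cons.
exact: loclipD.
Qed.

Lemma loclip_entry (R : realType) (V : normedModType R) m n (f : V -> 'M[R]_(m,
  n))
    x0 i j : loclip f x0 -> loclip (fun x => f x i j) x0.
Proof.
move=> [K KP]; exists K; apply: filterS KP => z; apply: le_trans.
by have := ler_coord_norm (f z.1 - f z.2) i j; rewrite mxE [X in _ + X]mxE.
Qed.

Lemma loclip_mx (R : realType) (V : normedModType R) m n (f : V -> 'M[R]_(m,
  n)) x0 :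
  (forall i j, loclip (fun x => f x i j) x0) -> loclip f x0.
Proof.
move=> H.
have /choice[K KP] : forall ij : 'I_m * 'I_n, exists C : R,
    \forall z \near (x0, x0),
      `|f z.1 ij.1 ij.2 - f z.2 ij.1 ij.2| <= C * `|z.1 - z.2|.
  by move=> [i j]; exact: H.
exists (\sum_ij `|K ij|); near=> z.
apply: mx_norm_le => [|i j]; first by rewrite mulr_ge0// sumr_ge0.
rewrite mxE [X in _ + X]mxE.
have zP : forall ij : 'I_m * 'I_n,
    `|f z.1 ij.1 ij.2 - f z.2 ij.1 ij.2| <= K ij * `|z.1 - z.2|.
  by near: z; apply: filter_forall.
apply: le_trans (zP (i, j)) _; rewrite ler_wpM2r//.
apply: le_trans (ler_norm _) _.
by rewrite (bigD1 (i, j))//= lerDl sumr_ge0.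
Unshelve. all: by end_near. Qed.

Lemma loclip_comp1 (R : realType) (U V W : normedModType R) (f : V -> W)
    (p : U -> V) x0 :
  (forall x y, `|p x - p y| <= `|x - y|) -> loclip f (p x0) -> loclip (f \o p)
    x0.
Proof.
move=> pP [K /nbhs_pairP[r r0 rP]]; exists `|K|; apply/nbhs_pairP.
exists r => // x y xr yr /=.
have /= := rP (p x) (p y) (le_lt_trans (pP _ _) xr) (le_lt_trans (pP _ _) yr).
move/le_trans; apply; apply: (@le_trans _ _ (`|K| * `|p x - p y|)).
  by rewrite ler_wpM2r// ler_norm.
by rewrite ler_wpM2l.
Qed.

Lemma loclip_pair (R : realType) (U V W : normedModType R) (f : U -> V)
    (g : U -> W) x0 :
  loclip f x0 -> loclip g x0 -> loclip (fun x => (f x, g x)) x0.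
Proof.
move=> [K KP] [L LP]; exists (`|K| + `|L|); near=> z.
rewrite [leLHS]/Num.Def.normr/= ge_max; apply/andP; split.
  apply: (@le_trans _ _ (K * `|z.1 - z.2|)); first by near: z.
  by rewrite ler_wpM2r// (le_trans (ler_norm K))// lerDl.
apply: (@le_trans _ _ (L * `|z.1 - z.2|)); first by near: z.
by rewrite ler_wpM2r// (le_trans (ler_norm L))// lerDr.
Unshelve. all: by end_near. Qed.


(** [K] need not be convex, so local constants cannot be chained along segments. Instead [K * K] is
    covered: near the diagonal the local bound applies, and away from it the quotient is bounded
    because the distance is bounded below. *)
Lemma compact_lipschitz (R : realType) (V W : normedModType R) (K : set V)
    (f : V -> W) :
  compact K -> (forall x, K x -> loclip f x) ->
  exists2 L : R, 0 <= L & forall x y, K x -> K y -> `|f x - f y| <= L * `|x -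
    y|.
Proof.
move=> cK lK; have cKK : compact (K `*` K) by exact: compact_setX.
have := (compact_near_coveringP _).1 cKK R (pinfty_nbhs R)
  (fun L z => `|f z.1 - f z.2| <= L * `|z.1 - z.2|) _.
move=> /(_ _)[|L0 [_ HL]]; last first.
  exists (`|L0| + 1) => [|x y Kx Ky]; first exact: addr_ge0.
  by apply: (HL _ _ (x, y)) => //; rewrite ltr_pwDr// ler_norm.
move=> [x0 y0] [/= Kx0 Ky0].
have [E|xy] := eqVneq x0 y0.
  rewrite -E; have [C CP] := lK _ Kx0.
  exists ([set z | `|f z.1 - f z.2| <= C * `|z.1 - z.2|], [set L | C < L]) =>
    /=.
    by split; [exact: CP|apply: nbhs_pinfty_gt; rewrite num_real].
  move=> [z L] [/= zC CL]; apply: le_trans zC _.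
  by rewrite ler_wpM2r// ltW.
have cx := loclip_cts (lK _ Kx0); have cy := loclip_cts (lK _ Ky0).
(* Each value of [f] moves by less than 1, which gives the 2 in [B]; moving each point by less than
   [D / 4] leaves a distance of at least [D / 2]. *)
pose D := `|x0 - y0|; pose B := `|f x0 - f y0| + 2.
have D0 : 0 < D by rewrite normr_gt0 subr_eq0.
have [r1 r10 r1P] := cts_distP cx ltr01.
have [r2 r20 r2P] := cts_distP cy ltr01.
exists ([set z | `|f z.1 - f z.2| <= B /\ D / 2 <= `|z.1 - z.2|],
        [set L | B / (D / 2) < L]) => /=.
  split; last by apply: nbhs_pinfty_gt; rewrite num_real.
  apply/nbhs_pairP; exists (Num.min (Num.min r1 r2) (D / 4)).
    by rewrite !lt_min r10 r20 divr_gt0.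
  move=> x y; rewrite !lt_min => /andP[/andP[x1 _] x2] /andP[/andP[_ y1] y2] /=.
  split.
    have -> : f x - f y = (f x0 - f y0) + ((f y0 - f y) - (f x0 - f x)).
      by rewrite opprB addrA [f x0 - f y0 + _]addrA subrK addrC addrA subrK.
    apply: le_trans (ler_normD _ _) _; rewrite lerD2l.
    apply: le_trans (ler_normB _ _) _.
    rewrite (distrC (f y0)) (distrC (f x0)).
    apply: (@le_trans _ _ (1 + 1)); last lra.
    by apply: lerD; rewrite ltW//; [exact: r2P|exact: r1P].
  have : D <= `|x - y| + `|x - x0| + `|y - y0|.
    rewrite -(distrC x0) /D.
    have -> : x0 - y0 = (x - y) + (x0 - x) + (y - y0).
      by rewrite [x - y + _]addrC [x0 - x + _]addrA subrK addrA subrK.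
    by apply: le_trans (ler_normD _ _) _; rewrite lerD2r; exact: ler_normD.
  lra.
move=> [z L] [/= [zB zD] BL]; apply: le_trans zB _.
have L0 : 0 <= L.
  by rewrite ltW// (le_lt_trans _ BL)// divr_ge0// ?divr_ge0 ?addr_ge0// ltW.
apply: (@le_trans _ _ (L * (D / 2))); last by rewrite ler_wpM2l.
by rewrite -ler_pdivrMr ?divr_gt0// ltW.
Qed.

(** The bound makes [e t * expR (- L * t)] nonincreasing and [e t * expR (L * t)] nondecreasing;
    each gives one inequality through the mean value theorem. The second one controls solutions
    backward in time. *)
Lemma gronwall (R : realType) (e e' : R -> R) (a b L : R) : a <= b ->
  (forall t, a <= t <= b -> is_derive t 1 e (e' t)) ->
  (forall t, a <= t <= b -> `|e' t| <= L * e t) ->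
  e b <= expR (L * (b - a)) * e a /\ e a <= expR (L * (b - a)) * e b.
Proof.
move=> ab de ee.
have mono (s : R) (g := fun t => e t * expR (s * t)) :
    exists2 c, a <= c <= b & g b - g a = (e' c + s * e c) * expR (s * c) * (b -
      a).
  have D t : a <= t <= b -> is_derive t 1 g ((e' t + s * e t) * expR (s * t)).
    move=> /de det.
    have ds : is_derive t 1 (s \*: (id : R -> R)) s.
      by apply: is_derive_eq (is_deriveZ _ _) _; rewrite [s *: 1]mulr1.
    have dx := is_derive1_comp (is_derive_expR (s * t)) ds.
    apply: is_derive_eq (is_deriveM det dx) _.
    rewrite /= -[e t *: _]/(e t * _) -[_ *: e' t]/(expR (s * t) * e' t); ring.
  have [||c] := @MVT_segment R g (fun t => (e' t + s * e t) * expR (s * t)) a b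
    ab.
  - by move=> t; rewrite in_itv/= => /andP[t0 t1]; apply: D; rewrite !ltW.
  - apply: derivable_within_continuous => t; rewrite in_itv/= => t01.
    by have [] := D _ t01.
  by rewrite in_itv/= => cab E; exists c.
have ba : 0 <= b - a by rewrite subr_ge0.
split.
  have [c cab E] := mono (- L).
  have le0 : (e' c + - L * e c) * expR (- L * c) * (b - a) <= 0.
    rewrite -mulrA mulr_le0_ge0// ?mulr_ge0 ?expR_ge0//.
    by rewrite mulNr subr_le0; apply: le_trans (ler_norm _) (ee _ cab).
  have : e b * expR (- L * b) * expR (L * b) <= e a * expR (- L * a) * expR (L
    * b).
    by rewrite ler_wpM2r ?expR_ge0// -subr_le0 E.
  by rewrite -!mulrA -!expRD mulNr addNr expR0 mulr1 mulNr addrC -mulrBr mulrC.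
have [c cab E] := mono L.
have ge0 : 0 <= (e' c + L * e c) * expR (L * c) * (b - a).
  rewrite !mulr_ge0 ?expR_ge0//.
  by rewrite -lerBlDr sub0r; apply: lerNnormlW; exact: ee.
have : e a * expR (L * a) * expR (- L * a) <= e b * expR (L * b) * expR (- L *
  a).
  by rewrite ler_wpM2r ?expR_ge0// -subr_ge0 E.
by rewrite -!mulrA -!expRD mulNr subrr expR0 mulr1 -mulrBr mulrC.
Qed.

Lemma is_derive_linear (R : realType) (V W : normedModType R)
    (L : {linear V -> W}) (c : R -> V) (t : R) c' :
  continuous L -> is_derive t 1 c c' -> is_derive t 1 (L \o c) (L c').
Proof.
move=> cL dc; apply: is_derive_comp_diff dc _.
split; [exact: linear_differentiable|exact: diff_lin].
Qed.

Lemma is_derive_fst (R : realType) (V W : normedModType R) (c : R -> V * W) (t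
  : R) c' :
  is_derive t 1 c c' -> is_derive t 1 (fun s => (c s).1) c'.1.
Proof.
by apply: (@is_derive_linear _ _ _ (@fst V W)) => -[x y]; exact: cvg_fst.
Qed.

Lemma is_derive_snd (R : realType) (V W : normedModType R) (c : R -> V * W) (t
  : R) c' :
  is_derive t 1 c c' -> is_derive t 1 (fun s => (c s).2) c'.2.
Proof.
by apply: (@is_derive_linear _ _ _ (@snd V W)) => -[x y]; exact: cvg_snd.
Qed.

Lemma is_derive_entry (R : realType) m n (c : R -> 'M[R]_(m, n)) (t : R) c' i j
  :
  is_derive t 1 c c' -> is_derive t 1 (fun s => c s i j) (c' i j).
Proof.
by move=> [dc <-]; split; [exact: (derivable_mxP _ _ _).1|exact: derive_coord].
Qed.

Lemma is_derive_pair (R : realType) (V W : normedModType R) (c : R -> V) (e : R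
  -> W)
    (t : R) c' e' :
  is_derive t 1 c c' -> is_derive t 1 e e' ->
  is_derive t 1 (fun s => (c s, e s)) (c', e').
Proof.
move=> [dc <-] [de <-]; move/derivable1_diffP : dc => dc; move/derivable1_diffP
  : de => de.
have := is_derive_diff (1 : R) (is_diff_pair (differentiableP dc)
  (differentiableP de)).
by rewrite -!deriveE.
Qed.

Lemma is_derive_dot (R : realType) d (u v : R -> 'cV[R]_d) (t : R) u' v' :
  is_derive t 1 u u' -> is_derive t 1 v v' ->
  is_derive t 1 (fun s => dot (u s) (v s)) (dot u' (v t) + dot (u t) v').
Proof.
move=> du dv.
have -> : (fun s => dot (u s) (v s)) = \sum_(i < d) (fun s => u s i 0 * v s i
  0).
  by apply/funext => s; rewrite dotE fct_sumE.
have -> : dot u' (v t) + dot (u t) v' =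
    \sum_(i < d) (u t i 0 *: v' i 0 + v t i 0 *: u' i 0).
  rewrite big_split/= addrC !dotE; congr (_ + _).
  by apply: eq_bigr => i _; rewrite mulrC.
apply: is_derive_sum => i.
exact: (is_deriveM (is_derive_entry i 0 du) (is_derive_entry i 0 dv)).
Qed.

(** The squared Euclidean norm on the product: it is differentiable, as Gronwall's inequality
    requires, which the max norm is not. *)
Definition qnorm {R : realType} {d : nat} (z : 'cV[R]_d * 'cV[R]_d) : R :=
  dot z.1 z.1 + dot z.2 z.2.

Lemma qnorm_ge0 (R : realType) d (z : 'cV[R]_d * 'cV[R]_d) : 0 <= qnorm z.
Proof. by rewrite addr_ge0 ?dot_ge0. Qed.

Lemma sqr_norm_le_qnorm (R : realType) d (z : 'cV[R]_d * 'cV[R]_d) :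
  `|z| ^+ 2 <= qnorm z.
Proof.
rewrite -(sqr_sqrtr (qnorm_ge0 z)) ler_pXn2r ?nnegrE ?sqrtr_ge0//.
exact: norm_le_enorm2.
Qed.

(** The derivative of [q] is twice a sum of two dot products. Each is at most
    [d * L * |c1 - c2| ^ 2] in the max norm, hence at most [d * L * q]; this is the origin of the
    rate [4 * d * L]. *)
Lemma gronwall_sol (R : realType) d (f : 'cV[R]_d * 'cV[R]_d -> 'cV[R]_d *
  'cV[R]_d)
    (K : set ('cV[R]_d * 'cV[R]_d)) (L a b : R) c1 c2 :
  a <= b -> 0 <= L ->
  (forall x y, K x -> K y -> `|f x - f y| <= L * `|x - y|) ->
  (forall t : R, a <= t <= b -> K (c1 t) /\ is_derive t 1 c1 (f (c1 t))) ->
  (forall t : R, a <= t <= b -> K (c2 t) /\ is_derive t 1 c2 (f (c2 t))) ->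
  let q := fun t => qnorm (c1 t - c2 t) in
  let C := expR (4 * d%:R * L * (b - a)) in
  q b <= C * q a /\ q a <= C * q b.
Proof.
move=> ab L0 fL H1 H2 q C.
pose D t := c1 t - c2 t; pose E t := f (c1 t) - f (c2 t).
apply: (@gronwall _ q (fun t => 2 * (dot (D t).1 (E t).1 + dot (D t).2 (E
  t).2))) => //.
- move=> t tab; have [_ d1] := H1 _ tab; have [_ d2] := H2 _ tab.
  have dD : is_derive t 1 D (E t) by exact: is_deriveB.
  have d3 := is_derive_dot (is_derive_fst dD) (is_derive_fst dD).
  have d4 := is_derive_dot (is_derive_snd dD) (is_derive_snd dD).
  apply: is_derive_eq (is_deriveD d3 d4) _.
  by rewrite ![dot (_ (E t)) _]dotC; ring.
- move=> t tab; have [K1 _] := H1 _ tab; have [K2 _] := H2 _ tab.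
  have lE : `|E t| <= L * `|D t| by exact: fL.
  have key (u v : 'cV[R]_d) : `|u| <= `|D t| -> `|v| <= `|E t| ->
      `|dot u v| <= d%:R * L * `|D t| ^+ 2.
    move=> uD vE; apply: le_trans (norm_dot_le _ _) _.
    rewrite -!mulrA ler_wpM2l//.
    apply: (@le_trans _ _ (`|D t| * (L * `|D t|))).
      by apply: ler_pM => //; exact: le_trans vE lE.
    by rewrite expr2 mulrCA.
  rewrite normrM ger0_norm//.
  apply: (@le_trans _ _ (2 * (d%:R * L * `|D t| ^+ 2 + d%:R * L * `|D t| ^+
    2))).
    rewrite ler_wpM2l//; apply: le_trans (ler_normD _ _) _.
    by apply: lerD; apply: key; rewrite ?norm_fst_le ?norm_snd_le.
  have -> : 2 * (d%:R * L * `|D t| ^+ 2 + d%:R * L * `|D t| ^+ 2) =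
      4 * d%:R * L * `|D t| ^+ 2 by ring.
  by rewrite ler_wpM2l ?mulr_ge0// sqr_norm_le_qnorm.
Qed.

Lemma is_derive_cts (R : realType) (V : normedModType R) (c : R -> V) (t : R)
  c' :
  is_derive t 1 c c' -> {for t, continuous c}.
Proof. by move=> [dc _]; apply: differentiable_continuous;
  apply/derivable1_diffP. Qed.

Lemma itv_min_max_ind (R : realType) (l u s t : R) :
  l < 0 < u -> l < s < u -> Num.min 0 s <= t <= Num.max 0 s -> l < t < u.
Proof.
move=> /andP[l0 u0] /andP[ls su]; rewrite ge_min le_max => /andP[/orP[h1|h1]
  /orP[h2|h2]];
  by apply/andP; split; lra.
Qed.

(** Over the compact time interval the two trajectories sweep out a compact subset of [D], which has
    one Lipschitz constant; Gronwall then keeps the distance at zero. [Num.min] and [Num.max] treat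
    both signs of [s] at once. *)
Lemma sol_unique (R : realType) d (f : 'cV[R]_d * 'cV[R]_d -> 'cV[R]_d *
  'cV[R]_d)
    (D : set ('cV[R]_d * 'cV[R]_d)) c1 c2 (s : R) :
  (forall z, D z -> loclip f z) -> c1 0 = c2 0 ->
  (forall t : R, Num.min 0 s <= t <= Num.max 0 s -> D (c1 t) /\ is_derive t 1
    c1 (f (c1 t))) ->
  (forall t : R, Num.min 0 s <= t <= Num.max 0 s -> D (c2 t) /\ is_derive t 1
    c2 (f (c2 t))) ->
  c1 s = c2 s.
Proof.
move=> fl c0 H1 H2.
have img (c : R -> 'cV[R]_d * 'cV[R]_d) :
    (forall t : R, Num.min 0 s <= t <= Num.max 0 s -> D (c t) /\ is_derive t 1
      c (f (c t))) ->
    compact (c @` `[Num.min 0 s, Num.max 0 s]).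
  move=> H; apply: continuous_compact; last exact: segment_compact.
  apply: derivable_within_continuous => t; rewrite in_itv/= => /H[_].
  by case.
pose K := c1 @` `[Num.min 0 s, Num.max 0 s] `|` c2 @` `[Num.min 0 s, Num.max 0
  s].
have cK : compact K by apply: compactU; exact: img.
have KD : K `<=` D.
  by move=> z [|] [t]; rewrite /= in_itv/= => tI <-; [exact: (H1 _ tI).1|exact:
    (H2 _ tI).1].
have [L L0 LP] := compact_lipschitz cK (fun z Kz => fl z (KD z Kz)).
have I1 t : Num.min 0 s <= t <= Num.max 0 s -> K (c1 t) /\ is_derive t 1 c1 (f
  (c1 t)).
  by move=> tI; split; [left; exists t; rewrite //= in_itv|exact: (H1 _ tI).2].
have I2 t : Num.min 0 s <= t <= Num.max 0 s -> K (c2 t) /\ is_derive t 1 c2 (f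
  (c2 t)).
  by move=> tI; split; [right; exists t; rewrite //= in_itv|exact: (H2 _ tI).2].
suff q0 : qnorm (c1 s - c2 s) <= 0.
  apply/eqP; rewrite -subr_eq0 -normr_eq0 -sqrf_eq0 eq_le sqr_ge0 andbT.
  exact: le_trans (sqr_norm_le_qnorm _) q0.
have qq0 : qnorm (c1 0 - c2 0) = 0 by rewrite c0 subrr /qnorm/= dot0l addr0.
have [s0|s0] := leP 0 s.
  move: I1 I2; rewrite min_l// max_r// => I1 I2.
  by have [+ _] := gronwall_sol s0 L0 LP I1 I2; rewrite qq0 mulr0.
move: I1 I2; rewrite (min_r (ltW s0)) (max_l (ltW s0)) => I1 I2.
by have [_] := gronwall_sol (ltW s0) L0 LP I1 I2; rewrite qq0 mulr0.
Qed.

(** * Primitives of closed 1-forms *)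

Lemma FTC2_is_derive (R : realType) (f g : R -> R) (a b l : R) : a <= b ->
  (forall t, a <= t <= b -> is_derive t 1 f (g t)) ->
  (forall t, a <= t <= b -> {for t, continuous g}) -> f b - f a = l ->
  (\int[lebesgue_measure]_(x in `[a, b]) (g x)%:E)%E = l%:E.
Proof.
rewrite le_eqVlt => /orP[/eqP <- _ _ <-|ab df cg <-].
  by rewrite set_itv1 integral_set1 subrr.
have fc t : a <= t <= b -> {for t, continuous f}.
  by move=> /df; exact: is_derive_cts.
rewrite (@continuous_FTC2 _ g f)//.
- by apply: continuous_in_subspaceT => t; rewrite inE/= in_itv/= => /cg.
- split=> [t||].
  + by rewrite in_itv/= => /andP[at_ tb]; have [] := df t; rewrite ?ltW.
  + by apply: cvg_at_right_filter; apply: fc; rewrite lexx ltW.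
  + by apply: cvg_at_left_filter; apply: fc; rewrite lexx ltW.
- move=> t; rewrite in_itv/= => /andP[at_ tb].
  by rewrite derive1E; have [|_ <-] := df t; rewrite ?ltW.
Qed.

(** The integral of the 1-form [F . dx] over the straight segment from [a] to [z], as in the
    Poincaré lemma. *)
Definition line_int {R : realType} {d : nat} (F : 'cV[R]_d -> 'cV[R]_d)
    (a z : 'cV[R]_d) : R :=
  \int[lebesgue_measure]_(t in `[0, 1]) dot (F (a + t *: (z - a))) (z - a).

Lemma is_derive_comp_along (R : realType) d (G : 'cV[R]_d -> R) g (x v :
  'cV[R]_d) (t : R) :
  is_diff (x + t *: v) G (dot g) ->
  is_derive t 1 (fun s : R => G (x + s *: v)) (dot g v).
Proof. by move=> H; exact: (is_derive_comp_diff (is_derive_line x v t) H). Qed.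

Lemma cts_line (R : realType) (V : normedModType R) (x v : V) :
  continuous (fun s : R => x + s *: v).
Proof. by move=> t; exact: is_derive_cts (is_derive_line x v t). Qed.

Lemma cts_dot (R : realType) (T : topologicalType) d (f g : T -> 'cV[R]_d) t :
  {for t, continuous f} -> {for t, continuous g} ->
  {for t, continuous (fun s => dot (f s) (g s))}.
Proof.
move=> cf cg; have -> : (fun s => dot (f s) (g s)) = fun s => \sum_i f s i 0 *
  g s i 0.
  by apply/funext => s; rewrite dotE.
rewrite /prop_for /continuous_at; apply: (@cvg_big _ _ +%R) => [|i _]; first
  exact: add_continuous.
apply: cvgM.
  exact: (continuous_comp cf (@coord_continuous _ _ _ i 0 _)).
exact: (continuous_comp cg (@coord_continuous _ _ _ i 0 _)).
Qed.

Lemma line_int_grad (R : realType) d (F : 'cV[R]_d -> 'cV[R]_d) G a z :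
  (forall t : R, 0 <= t <= 1 -> is_diff (a + t *: (z - a)) G (dot (F (a + t *:
    (z - a))))) ->
  (forall t : R, 0 <= t <= 1 -> {for a + t *: (z - a), continuous F}) ->
  line_int F a z = G z - G a.
Proof.
move=> dG cF; rewrite /line_int /Rintegral.
have -> : (\int[lebesgue_measure]_(t in `[0%R, 1%R])
    (dot (F (a + t *: (z - a))) (z - a))%:E = (G z - G a)%:E)%E; last by [].
apply: (@FTC2_is_derive R (fun t : R => G (a + t *: (z - a)))
  (fun t : R => dot (F (a + t *: (z - a))) (z - a)) 0 1 (G z - G a) ler01).
- by move=> t /dG; exact: is_derive_comp_along.
- move=> t /cF H; apply: cts_dot; last exact: cst_continuous.
  by apply: continuous_comp; [exact: cts_line|exact: H].
- by rewrite scale1r scale0r addr0 [a + _]addrC subrK.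
Qed.

Lemma compact_image_bounded (R : realType) (T : topologicalType) (V :
  normedModType R)
    (K : set T) (f : T -> V) :
  compact K -> (forall x, K x -> {for x, continuous f}) ->
  exists2 C : R, 0 <= C & forall x, K x -> `|f x| <= C.
Proof.
move=> cK cf.
have : compact (f @` K).
  apply: continuous_compact => //; apply: continuous_in_subspaceT => x.
  by rewrite inE => /cf.
move=> /compact_bounded[M [_ HM]].
exists (`|M| + 1) => [|x Kx]; first exact: addr_ge0.
by apply: HM; [rewrite ltr_pwDr// ler_norm|exists x].
Qed.

Lemma is_derive_line_gateauxV (R : realType) (V W : normedModType R) (G : V ->
  W)
    (x v : V) a :
  is_derive (0 : R) 1 (fun s : R => G (x + s *: v)) a -> is_derive x v G a.
Proof.
have E : (fun h : R => h^-1 *: (((fun s : R => G (x + s *: v)) \o shift 0) (h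
  *: 1)
    - G (x + 0 *: v))) =
    fun h : R => h^-1 *: ((G \o shift x) (h *: v) - G x).
  apply/funext => h /=; congr (_ *: (G _ - G _)).
    by rewrite addr0 [h *: 1]mulr1 addrC.
  by rewrite scale0r addr0.
by move=> [dG GE]; move: dG GE; rewrite /derivable/derive E.
Qed.

(** The Poincaré lemma on a ball. The line integral is differentiated under the integral sign in
    each direction [v], and [gateaux_grad] upgrades the result; compactness of the closed ball
    supplies the dominating constant. *)
Lemma ball_primitive (R : realType) d (F : 'cV[R]_d -> 'cV[R]_d) (O : set
  'cV[R]_d)
    c (r : R) z :
  Ck 1 O F -> (forall y, `|y - c| <= r -> O y) ->
  (forall y, O y -> forall u v, dot ('D_u F y) v = dot ('D_v F y) u) ->
  `|z - c| < r -> is_diff z (line_int F c) (dot (F z)).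
Proof.
move=> [Fd DFc] rO symF zr.
have [CF CF0 CFP] := compact_image_bounded (@compact_ball_le _ _ c r)
  (fun y (yr : `|y - c| <= r) => differentiable_continuous (Fd _ (rO _ yr))).
apply: (@gateaux_grad _ _ _ F [set y | `|y - c| < r]) => //; first last.
- by apply: differentiable_continuous; apply: Fd; apply: rO; exact: ltW.
- move=> y v yr; apply: is_derive_line_gateauxV.
  have [CD CD0 CDP] := compact_image_bounded (@compact_ball_le _ _ c r)
    (fun y (yr : `|y - c| <= r) => DFc v _ (rO _ yr)).
  (* For [|h| < dl] the point [y + h *: v] stays in the open ball. *)
  pose dl := (r - `|y - c|) / (`|v| + 1).
  have v1 : 0 < `|v| + 1 by rewrite ltr_wpDl.
  have dl0 : 0 < dl by rewrite divr_gt0// subr_gt0.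
  pose w h := y + h *: v - c.
  have wr h : - dl < h < dl -> `|w h| < r.
    rewrite -ltr_norml => hd; rewrite /w addrAC.
    apply: le_lt_trans (ler_normD _ _) _; rewrite -ltrBrDl normrZ.
    apply: (@le_lt_trans _ _ (`|h| * (`|v| + 1))); first by rewrite ler_wpM2l//
      lerDl.
    by rewrite -ltr_pdivlMr.
  pose p h t := c + t *: w h.
  have pr h (t : R) : - dl < h < dl -> 0 <= t <= 1 -> `|p h t - c| <= r.
    move=> /wr/ltW hd /andP[t0 t1]; rewrite /p addrC addKr normrZ ger0_norm//.
    by apply: le_trans hd; rewrite ler_piMl.
  pose f h t := dot (F (p h t)) (w h).
  pose f' h t := t * dot ('D_v F (p h t)) (w h) + dot (F (p h t)) v.
  have df h t : - dl < h < dl -> 0 <= t <= 1 -> is_derive h 1 (f ^~ t) (f' h t).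
    move=> hd t01.
    have dw : is_derive h 1 w v.
      have -> : w = fun h : R => (y - c) + h *: v by apply/funext => k; rewrite
        /w addrAC.
      exact: is_derive_line.
    have dp : is_derive h 1 (fun k => F (p k t)) (t *: 'D_v F (p h t)).
      have Fp := Fd _ (rO _ (pr _ _ hd t01)).
      have -> : (fun k => F (p k t)) = fun k : R => F ((c + t *: (y - c)) + k
        *: (t *: v)).
        apply/funext => k; rewrite /p /w addrAC scalerDr addrA.
        by rewrite !scalerA [k * t]mulrC.
      have E : p h t = (c + t *: (y - c)) + h *: (t *: v).
        by rewrite /p /w addrAC scalerDr addrA !scalerA [h * t]mulrC.
      have -> : t *: 'D_v F (p h t) = 'D_(t *: v) F (p h t).
        by rewrite !deriveE// linearZ.
      by rewrite E; apply: is_derive_along; rewrite -E.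
    apply: is_derive_eq (is_derive_dot dp dw) _.
    by rewrite dotZl.
  have cf h : - dl < h < dl -> forall t, 0 <= t <= 1 -> {for t, continuous (f
    h)}.
    move=> hd t t01; apply: cts_dot; last exact: cst_continuous.
    apply: continuous_comp; first exact: cts_line.
    by apply: differentiable_continuous; apply: Fd; apply: rO; exact: pr.
  have I0 : (`]-dl, dl[%classic : set R) 0 by rewrite /= in_itv/= oppr_lt0 dl0.
  have bd h t : (`]-dl, dl[%classic : set R) h -> (`[0, 1]%classic : set R) t ->
      `|partial1of2 f h t| <= d%:R * CD * r + d%:R * CF * `|v|.
    rewrite /= !in_itv/= => hd t01; rewrite partial1of2E.
    have [_ ->] := df _ _ hd t01.
    have p1 := pr _ _ hd t01.
    apply: le_trans (ler_normD _ _) _; apply: lerD.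
      rewrite normrM; case/andP: t01 => t0 t1; rewrite ger0_norm//.
      apply: (@le_trans _ _ `|dot ('D_v F (p h t)) (w h)|); first by rewrite
        ler_piMl.
      apply: le_trans (norm_dot_le _ _) _; rewrite -!mulrA ler_wpM2l// ler_pM//.
        exact: CDP.
      exact/ltW/wr.
    apply: le_trans (norm_dot_le _ _) _; rewrite -!mulrA ler_wpM2l//
      ler_wpM2r//.
    exact: CFP.
  have := @cvg_differentiation_under_integral
    R _ _ lebesgue_measure f `[0, 1] _ 0 (- dl) dl I0 _ _ _ _ _ bd.
  (* By symmetry of [DF], the derivative of the integrand is that of
     [t * dot (F (c + t *: (y - c))) v] in [t]. *)
  have -> : \int[lebesgue_measure]_(t in `[0, 1]) partial1of2 f 0 t = dot (F y)
    v.
    have w0 : w 0 = y - c by rewrite /w scale0r addr0.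
    rewrite /Rintegral.
    have -> : (\int[lebesgue_measure]_(t in `[0%R, 1%R]) (partial1of2 f 0 t)%:E
      =
       \int[lebesgue_measure]_(t in `[0%R, 1%R]) (f' 0 t)%:E)%E.
      apply: eq_integral => t; rewrite inE/= in_itv/= => t01.
      rewrite partial1of2E; congr EFin.
      by have [_ ->] := df _ _ I0 t01.
    have -> : (\int[lebesgue_measure]_(t in `[0%R, 1%R]) (f' 0 t)%:E = (dot (F
      y) v)%:E)%E; last by [].
    apply: (@FTC2_is_derive R (fun t : R => t * dot (F (c + t *: (y - c))) v)
      (f' 0)
      0 1 (dot (F y) v) ler01) => [t t01|t t01|].
      have pO : O (c + t *: (y - c)).
        by apply: rO; have := pr _ _ I0 t01; rewrite /p w0.
      have dF := is_derive_along (Fd _ pO).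
      have H := is_deriveM (is_derive_id t 1) (is_derive_dot dF (is_derive_cst
        v t 1)).
      apply: is_derive_eq H _.
      rewrite /f' /p w0 dot0r addr0 [in RHS](symF _ pO) [RHS]addrC.
      by rewrite addrC; congr (_ + _); exact: mulr1.
      have cl : {for t, continuous (p 0)} by exact: cts_line.
      have pO : O (p 0 t) by apply: rO; exact: pr.
      have cA : {for t, continuous (fun s => dot ('D_v F (p 0 s)) (w 0))}.
        apply: cts_dot; last exact: cst_continuous.
        exact: (continuous_comp cl (DFc v _ pO)).
      have cB : {for t, continuous (fun s => dot (F (p 0 s)) v)}.
        apply: cts_dot; last exact: cst_continuous.
        exact: (continuous_comp cl (differentiable_continuous (Fd _ pO))).
      exact: (cvgD (cvgM cvg_id cA) cB).
    by rewrite mul1r mul0r subr0 scale1r [c + _]addrC subrK.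
  move=> H.
  have {}H : h^-1 *: (line_int F c (y + (h + 0) *: v) - line_int F c (y + 0 *:
    v))
      @[h --> 0^'] --> dot (F y) v.
    have E k : line_int F c (y + k *: v) = \int[lebesgue_measure]_(t in `[0,
      1]) f k t by [].
    under eq_fun do rewrite !E.
    apply: H => //.
    - move=> h; rewrite /= in_itv/= => hd.
      apply: continuous_compact_integrable; first exact: segment_compact.
      by apply: continuous_in_subspaceT => t; rewrite inE/= in_itv/=; exact: cf.
    - move=> h t; rewrite /= !in_itv/= => hd t01.
      by have [] := df _ _ hd t01.
    - by move=> _; rewrite !addr_ge0 ?mulr_ge0// (le_trans _ (ltW zr)).
    - apply: continuous_compact_integrable; first exact: segment_compact.
      by apply: continuous_subspaceT => t; exact: cst_continuous.
  have E : (fun h : R => h^-1 *: (((fun s : R => line_int F c (y + s *: v)) \o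
    shift 0) (h *: 1)
      - line_int F c (y + 0 *: v))) =
    fun h => h^-1 *: (line_int F c (y + (h + 0) *: v) - line_int F c (y + 0 *:
      v)).
    by apply/funext => h; rewrite /= [h *: 1]mulr1.
  split; first by apply/cvg_ex; exists (dot (F y) v); rewrite E.
  by rewrite /derive E; exact/cvg_lim.
- exact: open_dist_lt.
Qed.

Lemma zero_diff_cst (R : realType) (V : normedModType R) (H : V -> R) z (r : R)
  :
  (forall y, `|y - z| < r -> is_diff y H (fun=> 0)) ->
  forall y, `|y - z| < r -> H y = H z.
Proof.
move=> dH y yr; have r0 : 0 < r by apply: le_lt_trans yr.
have seg (t : R) : 0 <= t <= 1 -> `|z + t *: (y - z) - z| < r.
  by apply: dist_segment_lt; rewrite ?subrr ?normr0// addrAC subrr add0r.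
have [|t t01] := @mvt_line _ _ H z (y - z); first by move=> t /seg/dH[].
have [d1 dE] := dH _ (seg _ t01).
rewrite [z + _]addrC subrK deriveE// dE => /eqP.
by rewrite subr_eq0 => /eqP.
Qed.

Lemma open_closed_ball (R : realType) (V : normedModType R) (O : set V) z :
  open O -> O z -> exists2 r : R, 0 < r & forall y, `|y - z| <= r -> O y.
Proof.
move=> oO Oz; have /nbhs_distP[r r0 rP] : \forall y \near z, O y.
  exact: open_nbhs_nbhs.
exists (r / 2); first by rewrite divr_gt0.
by move=> y yr; apply: rP; apply: le_lt_trans yr _; rewrite ltr_pdivrMr//
  mulr_natr mulr2n ltrDl.
Qed.

(** Near [m] let [G] be the primitive [line_int F m]. The integral of [F] from [p z] to [z] is
    [G z - G (p z)], and [G \o p] is constant, so [W] differs from [G] by a constant. The formula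
    for [W] does not mention [m], hence one function serves all of [M]. *)
Lemma near_potential (R : realType) d (F p : 'cV[R]_d -> 'cV[R]_d) (O M : set
  'cV[R]_d) m :
  open O -> Ck 1 O F -> M `<=` O ->
  (forall y, O y -> forall u v, dot ('D_u F y) v = dot ('D_v F y) u) ->
  (forall z, M z -> F z = 0) -> (forall z, M z -> p z = z) ->
  (forall z, O z -> M (p z)) -> (forall z, O z -> differentiable p z) ->
  M m ->
  let W := fun z => line_int F (p z) z in
  W m = 0 /\ \forall z \near m, is_diff z W (dot (F z)).
Proof.
move=> oO FC MO symF F0 pM Mp dp Mm W.
have [r r0 rO] := open_closed_ball oO (MO _ Mm).
have dG z : `|z - m| < r -> is_diff z (line_int F m) (dot (F z)).
  exact: ball_primitive FC rO symF.
have cF z : `|z - m| < r -> {for z, continuous F}.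
  by move=> zr; apply: differentiable_continuous; case: FC => + _; apply;
    apply/rO/ltW.
have [r1 r10 r1P] := cts_distP (differentiable_continuous (dp _ (MO _ Mm))) r0.
pose r2 := Num.min r r1.
have r20 : 0 < r2 by rewrite lt_min r0.
(* The differential of [line_int F m \o p] at [y] factors through [F (p y)], which is 0 because
   [p y] lies in [M]. *)
have Gp z : `|z - m| < r2 -> line_int F m (p z) = line_int F m m.
  move=> zr; rewrite -[RHS](congr1 (line_int F m) (pM _ Mm)).
  apply: (@zero_diff_cst _ _ (line_int F m \o p) m r2) => // y.
  rewrite lt_min => /andP[yr yr1].
  have Oy : O y by apply/rO/ltW.
  have py : `|p y - m| < r by have := r1P _ yr1; rewrite (pM _ Mm).
  have H := is_diff_comp (differentiableP (dp _ Oy)) (dG _ py).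
  apply: is_diff_eq H _.
  by apply/funext => v; rewrite /= F0 ?dot0l//; exact: Mp.
have WE z : `|z - m| < r2 -> W z = line_int F m z - line_int F m m.
  move=> zr; have := zr; rewrite lt_min => /andP[zr1 zr2].
  have py : `|p z - m| < r by have := r1P _ zr2; rewrite (pM _ Mm).
  have seg (t : R) : 0 <= t <= 1 -> `|p z + t *: (z - p z) - m| < r.
    by apply: dist_segment_lt => //; rewrite [p z + _]addrC subrK.
  rewrite -(Gp _ zr); apply: line_int_grad => t /seg H; [exact: dG|exact: cF].
split; first by rewrite WE ?subrr// normr0.
apply/nbhs_distP; exists r2 => // z zr.
apply: (@near_eq_is_diff _ _ _ (line_int F m - cst (line_int F m m))).
  apply/nbhs_distP; exists (r2 - `|z - m|); first by rewrite subr_gt0.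
  move=> y yr; rewrite WE// -[y](subrK z) -addrA.
  by apply: le_lt_trans (ler_normD _ _) _; rewrite -ltrBrDr.
move: zr; rewrite lt_min => /andP[zr _].
apply: is_diff_eq (is_diffB (dG _ zr) (is_diff_cst _ _)) _.
by rewrite subr0.
Qed.

(** A Lebesgue number argument: half of each local radius is spent on reaching the centre of a
    neighbourhood, the other half bounds [e]. *)
Lemma compact_uniform_near (R : realType) (V : normedModType R) (M : set V) (P
  : V -> Prop) :
  compact M -> (forall m, M m -> \forall z \near m, P z) ->
  exists2 e : R, 0 < e & forall m z, M m -> `|z - m| < e -> P z.
Proof.
move=> cM MP.
have := (compact_near_coveringP _).1 cM R (nbhs (0 : R)^'+)
  (fun e m => forall z, `|z - m| < e -> P z) _.
case=> [m Mm|e /= e0 H].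
  have /nbhs_distP[r r0 rP] := MP _ Mm.
  exists ([set y | `|y - m| < r / 2], [set e | e < r / 2]) => /=.
    split; first by apply/nbhs_distP; exists (r / 2); rewrite ?divr_gt0.
    by apply: nbhs_right_lt; rewrite divr_gt0.
  move=> [y e] /= [ym er] z zy; apply: rP.
  rewrite -[z](subrK y) -addrA [r](splitr); apply: le_lt_trans (ler_normD _ _)
    _.
  by apply: ltrD => //; exact: lt_trans zy er.
exists (e / 2); first by rewrite divr_gt0.
move=> m z Mm zm; apply: (H (e / 2) _ _ m) => //.
  by rewrite /= sub0r normrN gtr0_norm ?divr_gt0// ltr_pdivrMr// mulr_natr
    mulr2n ltrDl.
by rewrite divr_gt0.
Qed.

(** * The accumulated cost *)

(** The hypothesis makes the truth value of [P] locally constant. If [P b] failed, the indicator of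
    [P] would be continuous with values 1 and 0 at the ends, and the intermediate value theorem
    would give the value 1/2. *)
Lemma segment_induction (R : realType) (P : R -> Prop) (a b : R) : a <= b ->
  (forall s0, a <= s0 <= b -> exists2 e : R, 0 < e & forall s t,
     a <= s <= b -> a <= t <= b -> `|s - s0| < e -> `|t - s0| < e -> P s -> P
       t) ->
  P a -> P b.
Proof.
move=> ab H Pa; apply: contrapT => Pb.
pose g (s : R) : R := if pselect (P s) then 1 else 0.
(* [c] clamps to [a, b], which makes [g \o c] continuous on the whole line. *)
pose c (s : R) := Num.max a (Num.min b s).
have ca s : a <= c s <= b by rewrite /c le_max lexx/= ge_max ab ge_min lexx.
have cd s t (e : R) : `|s - t| < e -> `|c s - c t| < e.
  have key u : [\/ c u = a /\ u <= a, c u = u /\ a <= u <= b | c u = b /\ b <=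
    u].
    rewrite /c; have [bu|ub] := leP b u; first by rewrite (max_r ab); exact:
      Or33.
    have [au|ua] := leP a u; first by apply: Or32; rewrite (ltW ub).
    by apply: Or31; rewrite ltW.
  rewrite !ltr_norml => /andP[h1 h2].
  by have [[-> ?]|[-> /andP[? ?]]|[-> ?]] := key s;
    have [[-> ?]|[-> /andP[? ?]]|[-> ?]] := key t; apply/andP; split; lra.
have [||x _] := @IVT R (g \o c) a b (1 / 2) ab.
- apply: continuous_subspaceT => s0.
  have [e e0 eP] := H _ (ca s0).
  apply/cvgrPdist_lt => r r0; exists e => //= s; rewrite distrC => /cd se.
  have -> : g (c s0) = g (c s).
    have s0e : `|c s0 - c s0| < e by rewrite subrr normr0.
    rewrite /g; case: pselect => p1; case: pselect => p2 //.
      by exfalso; apply: p2; apply: (eP (c s0)) => //; rewrite distrC.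
    by exfalso; apply: p1; apply: (eP (c s)) => //; rewrite distrC.
  by rewrite subrr normr0.
- have -> : (g \o c) a = 1.
    by rewrite /= /g/c (min_r ab) maxxx; case: pselect.
  have -> : (g \o c) b = 0.
    by rewrite /= /g/c minxx (max_r ab); case: pselect.
  by rewrite (min_r ler01) (max_l ler01); apply/andP; split; lra.
by rewrite /= /g; case: pselect => _ /eqP; rewrite ?div1r; [lra|lra].
Qed.

(** The reflection [t -> - t] reduces this to an improper integral towards plus infinity, where
    nonnegativity of [f] gives the integral a meaning in the extended reals. *)
Lemma integral_Ny_FTC (R : realType) (f E : R -> R) (T : R) :
  (forall t, t <= T -> is_derive t 1 E (f t)) ->
  (forall t, t <= T -> {for t, continuous f}) ->
  (forall t, t <= T -> 0 <= f t) ->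
  E t @[t --> -oo] --> 0 ->
  (\int[lebesgue_measure]_(t in `]-oo, T]) (f t)%:E)%E = (E T)%:E.
Proof.
move=> dE cf f0 E0.
have := @ge0_integration_by_substitutionNy R f (- T); rewrite opprK => ->;
  first last.
- by move=> t; rewrite in_itv/= => /ltW; exact: f0.
- by apply: continuous_in_subspaceT => t; rewrite inE/= in_itv/=; exact: cf.
have dN (t : R) : is_derive t 1 (-%R : R -> R) (-1) by exact: is_deriveNid.
have dF t : - T <= t -> is_derive t 1 (fun t => - E (- t)) (f (- t)).
  move=> tT; have tT' : - t <= T by rewrite lerNl.
  have H := is_deriveN (is_derive1_comp (dE _ tT') (dN t)).
  by apply: is_derive_eq H _; rewrite mulrN1 opprK.
rewrite (@ge0_continuous_FTC2y _ (f \o -%R) (fun t => - E (- t)) _ 0).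
- by rewrite opprK sub0e -EFinN opprK.
- by move=> t tT; apply: f0; rewrite lerNl.
- apply: continuous_in_subspaceT => t; rewrite inE/= in_itv/= andbT => tT.
  apply: continuous_comp; first exact: is_derive_cts (dN t).
  by apply: cf; rewrite lerNl.
- by rewrite -[0]oppr0; apply: cvgN; exact: ((cvgNy_compNP E _).1 E0).
- by move=> t /ltW/dF[].
- apply: cvg_at_right_filter; have := dF (- T) (lexx _); exact: is_derive_cts.
- move=> t; rewrite in_itv/= andbT => /ltW/dF[_ <-].
  by rewrite derive1E.
Qed.

Lemma ge0_integral_Ny_cat (R : realType) (f : R -> R) (s t : R) : s <= t ->
  (forall u, u <= t -> {for u, continuous f}) -> (forall u, u <= t -> 0 <= f u)
    ->
  (\int[lebesgue_measure]_(u in `]-oo, t]) (f u)%:E =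
   \int[lebesgue_measure]_(u in `]-oo, s]) (f u)%:E +
   \int[lebesgue_measure]_(u in `[s, t]) (f u)%:E)%E.
Proof.
move=> st cf f0.
have mf : measurable_fun `]-oo, t] f.
  apply: measurable_realfun.subspace_continuous_measurable_fun => //.
  by apply: continuous_in_subspaceT => u; rewrite inE/= in_itv/=; exact: cf.
have E : (`]-oo, t]%classic : set R) = `]-oo, s] `|` `]s, t].
  by rewrite -itv_bndbnd_setU.
rewrite [in LHS]E ge0_integral_setU//=.
- rewrite integral_itv_obnd_cbnd//; apply/measurable_realfun.measurable_EFinP;
  apply: measurable_funS mf => //.
  exact: subset_itvr.
- by rewrite -E; exact/measurable_realfun.measurable_EFinP.
- move=> u uI; rewrite lee_fin; apply: f0.
  by case: uI; rewrite in_itv/=; [move=> us; exact: le_trans us st|case/andP].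
- apply/disj_set2P; rewrite -subset0 => u [] /=; rewrite !in_itv/= => us
  /andP[su _].
  by move: (le_lt_trans us su); rewrite ltxx.
Qed.

Lemma dist_between (R : realType) (s q u v w : R) :
  u <= w <= v -> `|u - s| < q -> `|v - s| < q -> `|w - s| < q.
Proof.
rewrite !ltr_norml => /andP[uw wv] /andP[h1 h2] /andP[h3 h4].
by apply/andP; split; lra.
Qed.

(** The propagation argument, stated for an abstract family of curves [X] with velocity [X']. The
    conclusion equates an extended integral with a real number, so finiteness near [x] is part of
    it. *)
Lemma value_grad (R : realType) d (F : 'cV[R]_d -> 'cV[R]_d) (O O1 M : set
  'cV[R]_d)
    (W : 'cV[R]_d -> R) (X X' : 'cV[R]_d -> R -> 'cV[R]_d) :
  let L := fun y t => dot (F (X y t)) (X' y t) in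
  open O -> open O1 -> Ck 1 O F ->
  (forall y, O y -> forall u v, dot ('D_u F y) v = dot ('D_v F y) u) ->
  compact M ->
  (forall m, M m -> W m = 0 /\ \forall z \near m, is_diff z W (dot (F z))) ->
  (forall y, O1 y -> X y 0 = y) ->
  (forall y (t : R), O1 y -> t <= 0 -> O (X y t)) ->
  (forall y (t : R), O1 y -> t <= 0 -> is_derive t 1 (X y) (X' y t)) ->
  (forall y (t : R), O1 y -> t <= 0 -> 0 <= L y t) ->
  (forall y (t : R), O1 y -> t <= 0 -> {for t, continuous (L y)}) ->
  (forall x (T e : R), O1 x -> T <= 0 -> 0 < e ->
     \forall y \near x, forall t : R, T <= t <= 0 -> `|X y t - X x t| < e) ->
  (forall e : R, 0 < e -> exists2 T : R, T <= 0 & forall y (t : R), O1 y -> t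
    <= T ->
     exists2 m, M m & `|X y t - m| < e) ->
  forall x, O1 x -> exists G : 'cV[R]_d -> R, is_diff x G (dot (F x)) /\
    \forall y \near x,
      (\int[lebesgue_measure]_(t in `]-oo, 0%R]) (L y t)%:E)%E = (G y)%:E.
Proof.
move=> L oO oO1 FC symF cM WM X0 XO dX L0 cL Xdep XM x O1x.
have nO1 : \forall y \near x, O1 y by exact: open_nbhs_nbhs.
(* The primitive [G] may change with [s]; only its germ at [X x s] matters, as [X y s] is close to
   [X x s] for [y] near [x]. *)
pose P s := exists2 G : 'cV[R]_d -> R, \forall z \near X x s, is_diff z G (dot
  (F z)) &
    \forall y \near x, (\int[lebesgue_measure]_(t in `]-oo, s]) (L y t)%:E)%E =
      (G (X y s))%:E.
suff [G GF GV] : P 0.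
  exists G; split; first by have := nbhs_singleton GF; rewrite X0.
  near=> y; rewrite -{2}(X0 y); last by near: y.
  by near: y.
have [e e0 eW] := compact_uniform_near cM (fun m Mm => (WM m Mm).2).
have [T T0 TP] := XM _ e0.
(* Up to time [T] all orbits remain where [W] is a primitive, so the cost is the increment of [W]
   along the orbit. *)
have PT : P T.
  have nW y t : O1 y -> t <= T -> \forall z \near X y t, is_diff z W (dot (F
    z)).
    move=> O1y tT; have [m Mm me] := TP _ _ O1y tT.
    apply/nbhs_distP; exists (e - `|X y t - m|); first by rewrite subr_gt0.
    move=> z ze; apply: eW Mm _; rewrite -[z](subrK (X y t)) -addrA.
    by apply: le_lt_trans (ler_normD _ _) _; rewrite -ltrBrDr.
  exists W; first exact: nW.
  near=> y; have O1y : O1 y by near: y.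
  apply: (@integral_Ny_FTC _ (L y) (W \o X y) T).
  - move=> t tT.
    apply: (@is_derive_comp_diff _ _ _ W (dot (F (X y t))) (X y) t (X' y t)).
      by apply: dX => //; exact: le_trans tT T0.
    exact: nbhs_singleton (nW _ _ O1y tT).
  - by move=> t tT; apply: cL => //; exact: le_trans tT T0.
  - by move=> t tT; apply: L0 => //; exact: le_trans tT T0.
  (* [W] vanishes on [M] and is continuous there, uniformly by compactness, so it tends to 0 along
     an orbit approaching [M]. *)
  - apply/cvgrPdist_lt => r r0.
    have nr m : M m -> \forall z \near m, `|W z| < r.
      move=> Mm; have [Wm /nbhs_singleton[dW _]] := WM _ Mm.
      have [q q0 qP] := cts_distP (differentiable_continuous dW) r0.
      by apply/nbhs_distP; exists q => // z /qP; rewrite Wm subr0.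
    have [e1 e10 e1P] := compact_uniform_near cM nr.
    have [T1 _ T1P] := XM _ e10.
    near=> t; rewrite sub0r normrN.
    have [|m Mm me] := T1P y t O1y; last exact: e1P me.
    by near: t; apply: nbhs_ninfty_le; rewrite num_real.
apply: (segment_induction T0 _ PT) => s0 /andP[Ts0 s00].
have Oz := XO _ _ O1x s00.
have [r r0 rO] := open_closed_ball oO Oz.
have [GB dGB] : exists GB : 'cV[R]_d -> R,
    forall z, `|z - X x s0| < r -> is_diff z GB (dot (F z)).
  by exists (line_int F (X x s0)) => z; exact: ball_primitive FC rO symF.
have r2 : 0 < r / 2 by rewrite divr_gt0.
(* Half of [r] is for the motion of [X x] in time, the other half for the change of initial point;
   together they keep nearby orbits in the ball where [GB] is a primitive. *)
have [q q0 qP] := cts_distP (is_derive_cts (dX _ _ O1x s00)) r2.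
exists q => // s t /andP[Ts s_0] /andP[Tt t_0] sq tq [G GF GV].
have /nbhs_distP[rG rG0 rGP] := GF.
pose rho := Num.min rG (r / 2).
have rho0 : 0 < rho by rewrite lt_min rG0.
have inB y u : (forall v, T <= v <= 0 -> `|X y v - X x v| < r / 2) ->
    T <= u <= 0 -> `|u - s0| < q -> `|X y u - X x s0| < r.
  move=> yP uT uq; rewrite -[X y u](subrK (X x u)) -addrA [r]splitr.
  apply: le_lt_trans (ler_normD _ _) _; apply: ltrD; [exact: yP|exact: qP].
have dH y : `|y - X x s| < rho -> is_diff y (G - GB) (fun=> 0).
  rewrite lt_min => /andP[y1 y2].
  have yB : `|y - X x s0| < r.
    rewrite -[y](subrK (X x s)) -addrA [r]splitr.
    by apply: le_lt_trans (ler_normD _ _) _; apply: ltrD => //; exact: qP.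
  apply: is_diff_eq (is_diffB (rGP _ y1) (dGB _ yB)) _.
  by rewrite subrr.
have Hc z : `|z - X x s| < rho -> G z = GB z + (G (X x s) - GB (X x s)).
  move=> zr; have := zero_diff_cst dH zr; rewrite !fctE => <-.
  by rewrite [GB z + _]addrC subrK.
(* Two primitives of [F] on a ball differ by a constant; shifting [GB] by it continues [G] to the
   whole ball around [X x s0]. *)
pose k := G (X x s) - GB (X x s).
exists (GB + cst k).
  apply/nbhs_distP; exists (r / 2) => // z zr.
  have zB : `|z - X x s0| < r.
    rewrite -[z](subrK (X x t)) -addrA [r]splitr.
    by apply: le_lt_trans (ler_normD _ _) _; apply: ltrD => //; exact: qP.
  by apply: is_diff_eq (is_diffD (dGB _ zB) (is_diff_cst _ _)) _; rewrite addr0.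
near=> y.
have O1y : O1 y by near: y.
have yP : forall v, T <= v <= 0 -> `|X y v - X x v| < r / 2.
  by near: y; exact: Xdep.
have yrho : forall v, T <= v <= 0 -> `|X y v - X x v| < rho.
  by near: y; exact: Xdep.
have sE : (\int[lebesgue_measure]_(t in `]-oo, s]) (L y t)%:E)%E = (GB (X y s)
  + k)%:E.
  by rewrite -Hc; [near: y|apply: yrho; rewrite Ts].
have FT a b : T <= a -> a <= b -> b <= 0 -> `|a - s0| < q -> `|b - s0| < q ->
    (\int[lebesgue_measure]_(t in `[a, b]) (L y t)%:E)%E = (GB (X y b) - GB (X
      y a))%:E.
  move=> Ta ab b0 aq bq.
  apply: (@FTC2_is_derive _ (GB \o X y) (L y)) => // u /andP[au ub].
    have u0 := le_trans ub b0.
    apply: (@is_derive_comp_diff _ _ _ GB (dot (F (X y u))) (X y) u (X' y u)).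
      exact: dX.
    apply: dGB; apply: inB => //; first by rewrite (le_trans Ta).
    by apply: dist_between aq bq; rewrite au.
  exact: cL (le_trans ub b0).
have [st|/ltW ts] := leP s t.
  rewrite (@ge0_integral_Ny_cat _ _ s t st).
  - by rewrite sE FT// -EFinD !fctE; congr EFin; ring.
  - by move=> u ut; apply: cL => //; exact: le_trans ut t_0.
  - by move=> u ut; apply: L0 => //; exact: le_trans ut t_0.
(* For [t <= s] the cost between [t] and [s] has to be subtracted, which is legitimate because the
   finite total excludes an infinite integral up to [t]. *)
move: sE; rewrite (@ge0_integral_Ny_cat _ _ t s ts).
- rewrite FT//; set I := (\int[lebesgue_measure]_(u in `]-oo, t]) _)%E.
  by case: I => [v||]//; rewrite -EFinD => -[H]; congr EFin; rewrite !fctE; lra.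
- by move=> u ut; apply: cL => //; exact: le_trans ut s_0.
- by move=> u ut; apply: L0 => //; exact: le_trans ut s_0.
Unshelve. all: by end_near. Qed.

Lemma loclip_fst (R : realType) (V W U : normedModType R) (f : V -> U) (z : V *
  W) :
  loclip f z.1 -> loclip (fun z => f z.1) z.
Proof. by move=> fz; apply: (loclip_comp1 (p := fst)) => // x y; exact:
  (norm_fst_le (x - y)). Qed.

Lemma loclip_id (R : realType) (V : normedModType R) (x : V) : loclip (fun y =>
  y) x.
Proof. by exists 1; apply/nbhs_pairP; exists 1 => // y z _ _; rewrite mul1r.
  Qed.

Lemma loclip_snd (R : realType) (V W U : normedModType R) (f : W -> U) (z : V *
  W) :
  loclip f z.2 -> loclip (fun z => f z.2) z.
Proof. by move=> fz; apply: (loclip_comp1 (p := snd)) => // x y; exact: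
  (norm_snd_le (x - y)). Qed.

(** * Flows *)

(** Every entry is a polynomial in [z.2] and in entries of [A], [b] and their first derivatives.
    These derivatives are C^1, hence locally Lipschitz, because [A] and [b] are C^2. *)
Lemma Hfield_loclip (R : realType) d (Omega : set 'cV[R]_d) b A z :
  open Omega -> Ck 2 Omega b -> Ck 2 Omega A -> Hdom Omega z ->
  loclip (Hfield b A) z.
Proof.
move=> oO b2 A2 [/= Oz _].
have lA i k : loclip (fun z : 'cV[R]_d * 'cV[R]_d => A z.1 i k) z.
  exact: (loclip_fst (loclip_entry i k (C1_loclip oO (Ck_pred A2) Oz))).
have lb i k : loclip (fun z : 'cV[R]_d * 'cV[R]_d => b z.1 i k) z.
  exact: (loclip_fst (loclip_entry i k (C1_loclip oO (Ck_pred b2) Oz))).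
have lDA v i k : loclip (fun z : 'cV[R]_d * 'cV[R]_d => 'D_v A z.1 i k) z.
  exact: (loclip_fst (loclip_entry i k (C1_loclip oO (A2.2 v) Oz))).
have lDb v i k : loclip (fun z : 'cV[R]_d * 'cV[R]_d => 'D_v b z.1 i k) z.
  exact: (loclip_fst (loclip_entry i k (C1_loclip oO (b2.2 v) Oz))).
have l2 i k : loclip (fun z : 'cV[R]_d * 'cV[R]_d => z.2 i k) z.
  exact: (loclip_snd (loclip_entry i k (loclip_id _))).
apply: loclip_pair; apply: loclip_mx => i j.
  have -> : (fun x : 'cV[R]_d * 'cV[R]_d => (2 *: (A x.1 *m x.2) + b x.1) i j) =
      fun x => 2 * (\sum_k A x.1 i k * x.2 k j) + b x.1 i j.
    by apply/funext => x; rewrite !mxE.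
  apply: loclipD => //; apply: loclipM; first exact: loclip_cst.
  by apply: loclip_sum => k; apply: loclipM.
have -> : (fun x : 'cV[R]_d * 'cV[R]_d =>
      (- (\col_i0 bilin ('D_(evec i0) A x.1) x.2 x.2) - (jac b x.1)^T *m x.2) i
        j) =
    fun x => -1 * (\sum_k (\sum_l x.2 l 0 * 'D_(evec i) A x.1 l k) * x.2 k 0) +
      -1 * (\sum_k 'D_(evec i) b x.1 k 0 * x.2 k j).
  apply/funext => x; rewrite !mxE !mulN1r; congr (- _ - _).
    by rewrite /bilin mxE; apply: eq_bigr => k _; rewrite mxE; congr (_ * _);
      apply: eq_bigr => l _; rewrite mxE.
  by apply: eq_bigr => k _; rewrite !mxE.
apply: loclipD; apply: loclipM; try exact: loclip_cst.
  apply: loclip_sum => k; apply: loclipM => //.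
  by apply: loclip_sum => l; apply: loclipM.
by apply: loclip_sum => k; apply: loclipM.
Qed.

(** [flow] selects some endpoint by choice; uniqueness of solutions leaves only one candidate. *)
Lemma flow_relP (R : realType) d (f : 'cV[R]_d * 'cV[R]_d -> 'cV[R]_d *
  'cV[R]_d) D
    (t : R) x y :
  (forall z, D z -> loclip f z) -> flow_rel f D t x y -> flow f D t x = y.
Proof.
move=> fl xy; have : flow_rel f D t x (flow f D t x) by apply: (@xgetPex _ 0
  [set y | flow_rel f D t x y]); exists y.
case: xy => l [u [c [lu tu c0 <- cP]]] [l' [u' [c' [lu' tu' c0' <- cP']]]].
apply: (sol_unique fl); first by rewrite c0 c0'.
  by move=> s /(itv_min_max_ind lu' tu'); exact: cP'.
by move=> s /(itv_min_max_ind lu tu); exact: cP.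
Qed.

Lemma flow_sol (R : realType) d (f : 'cV[R]_d * 'cV[R]_d -> 'cV[R]_d *
  'cV[R]_d) D
    (t : R) x :
  (forall z, D z -> loclip f z) -> flow_dom f D t x ->
  [/\ flow f D 0 x = x, D (flow f D t x) &
      is_derive t 1 (fun s => flow f D s x) (f (flow f D t x))].
Proof.
move=> fl [y [l [u [c [lu tu c0 ct cP]]]]].
have E s : l < s < u -> flow f D s x = c s.
  by move=> su; apply: flow_relP => //; exists l, u, c.
rewrite (E 0)// (E t)//; split=> //; first by have [] := cP _ tu.
have [_ dc] := cP _ tu.
apply: near_eq_is_derive dc.
have : \forall s \near t, s \in `]l, u[ by apply: near_in_itvoo; rewrite in_itv.
by apply: filterS => s; rewrite in_itv/= => /E.
Qed.

Lemma bilin0r (R : realType) d (B : 'M[R]_d) y : bilin B y 0 = 0.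
Proof. by rewrite bilinE mulmx0 dot0r. Qed.

Lemma Hfield0 (R : realType) d b (A : 'cV[R]_d -> 'M[R]_d) x :
  Hfield b A (x, 0) = (b x, 0).
Proof.
rewrite /Hfield/= !mulmx0 scaler0 add0r subr0; congr pair.
by apply/colP => i; rewrite !mxE bilin0r oppr0.
Qed.

Lemma flow_rel_lift (R : realType) d (Omega : set 'cV[R]_d) b A (t : R) x y :
  flow_rel b Omega t x y -> flow_rel (Hfield b A) (Hdom Omega) t (x, 0) (y, 0).
Proof.
move=> [l [u [c [lu tu c0 ct cP]]]]; exists l, u, (fun s => (c s, 0)).
split=> //; [by rewrite c0|by rewrite ct|move=> s /cP[Oc dc]; split => //].
by rewrite Hfield0; apply: is_derive_pair.
Qed.

(** Uniqueness for the base flow is inherited from the Hamiltonian one through the invariant zero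
    section [p = 0]. *)
Lemma flow_base (R : realType) d (Omega : set 'cV[R]_d) b A (t : R) x y :
  (forall z, Hdom Omega z -> loclip (Hfield b A) z) ->
  flow_rel b Omega t x y -> flow b Omega t x = y.
Proof.
move=> fl xy.
have : flow_rel b Omega t x (flow b Omega t x) by apply: (@xgetPex _ 0 [set y |
  flow_rel b Omega t x y]); exists y.
move=> /(flow_rel_lift A)/(flow_relP fl) E.
by have := flow_relP fl (flow_rel_lift A xy); rewrite E => -[].
Qed.

Lemma tangent_graph (R : realType) d (O : set 'cV[R]_d) (F : 'cV[R]_d ->
  'cV[R]_d) W x v :
  open O -> O x -> differentiable F x -> graph_on O F `<=` W ->
  tangent W (x, F x) (v, 'D_v F x).
Proof.
move=> oO Ox dF GW; exists (fun s : R => (x + s *: v, F (x + s *: v))).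
have x0 : x + 0 *: v = x by rewrite scale0r addr0.
split; first by rewrite x0.
  have : {for 0, continuous (fun s : R => x + s *: v)} by exact: cts_line.
  rewrite /prop_for /continuous_at x0 => /(_ O) H.
  have {}H : \forall s \near (0 : R), O (x + s *: v) by apply: H; exact:
    open_nbhs_nbhs.
  by apply: filterS H => s Os; apply: GW; exists (x + s *: v).
apply: is_derive_pair; first exact: is_derive_line.
by rewrite -{2}x0; apply: is_derive_along; rewrite x0.
Qed.

Lemma sympos_unitmx (R : realType) d (B : 'M[R]_d) : sympos B -> B \in unitmx.
Proof.
move=> [BT Bp]; rewrite -row_free_unit -kermx_eq0; apply/eqP/row_matrixP => i.
rewrite row0; apply: contrapT => /eqP u0.
have := Bp (row i (kermx B))^T; rewrite -trmx0 (inj_eq trmx_inj) => /(_ u0).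
by rewrite /bilin trmxK -row_mul mulmx_ker row0 mul0mx mxE ltxx.
Qed.

Lemma Lag_Hvel (R : realType) d b (A : 'cV[R]_d -> 'M[R]_d) x p :
  sympos (A x) -> Lag b A x (2 *: (A x *m p) + b x) = bilin (A x) p p.
Proof.
move=> As; have Au := sympos_unitmx As.
rewrite /Lag; have -> : b x - (2 *: (A x *m p) + b x) = - (2 *: (A x *m p)).
  by rewrite opprD addrCA subrr addr0.
rewrite !bilinE mulmxN dotNl dotNr opprK -scalemxAr mulmxA mulVmx// mul1mx.
rewrite dotZl dotZr !mulrA -[4^-1 * 2 * 2]mulrA -natrM mulVf ?mul1r
  ?pnatr_eq0//.
by rewrite dot_trmxl As.1.
Qed.

(** * Zeros and Hessians of gradients *)

(** The stack of [N] over [P] has trivial kernel. Its transpose [B] is therefore row free and has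
    the right inverse [pinvmx B], whose norm gives the constant. *)
Lemma inj_lower_bound (R : realType) d (N P : 'M[R]_d) :
  (forall h : 'cV[R]_d, P *m h = 0 -> N *m h = 0 -> h = 0) ->
  exists2 c : R, 0 <= c & forall h : 'cV[R]_d, P *m h = 0 -> `|h| <= c * `|N *m
    h|.
Proof.
move=> inj; pose B := row_mx N^T P^T.
have fB : row_free B.
  rewrite -kermx_eq0; apply/eqP/row_matrixP => i; rewrite row0.
  have : row i (kermx B) *m B = 0 by rewrite -row_mul mulmx_ker row0.
  rewrite mul_mx_row -row_mx0 => /eq_row_mx[N0 P0].
  by apply: trmx_inj; rewrite trmx0; apply: inj;
    apply: trmx_inj; rewrite trmx_mul trmxK trmx0.
exists ((d + d)%:R * `|pinvmx B|) => [|h Ph]; first by rewrite mulr_ge0.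
have -> : `|h| = `|row_mx (N *m h)^T 0 *m pinvmx B|.
  have -> : row_mx (N *m h)^T 0 = h^T *m B.
    by rewrite mul_mx_row -!trmx_mul Ph trmx0.
  by rewrite -mulmxA mulmxVp// mulmx1 norm_trmx.
apply: le_trans (norm_mulmx_le _ _) _; rewrite mulrAC ler_wpM2l ?mulr_ge0//.
apply: mx_norm_le => // i j; case: (split_ordP j) => k ->.
  by rewrite row_mxEl mxE ler_coord_norm.
by rewrite row_mxEr mxE normr0.
Qed.

Lemma is_derive_unique (R : realType) (V W : normedModType R) (f : V -> W) x v
  a b :
  is_derive x v f a -> is_derive x v f b -> a = b.
Proof. by move=> [_ <-] [_ <-]. Qed.

Lemma pid_mxE (R : realType) d r (y : 'cV[R]_d) (i : 'I_d) :
  (pid_mx r *m y) i 0 = if (i < r)%N then y i 0 else 0.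
Proof.
rewrite mxE (bigD1 i)//= big1 ?addr0; last first.
  by move=> k ki; rewrite mxE eq_sym -val_eqE/= in ki *; rewrite (negbTE ki)
    mul0r.
by rewrite mxE eqxx/=; case: ifP; rewrite (mul1r, mul0r).
Qed.

(** Supplies the accuracy at which the linearization error in [zero_set_near] can be absorbed. *)
Lemma small_factor (R : realType) (k K : R) : 0 <= k -> 0 <= K ->
  exists2 e : R, 0 < e <= 1 & k * (e * (K + 1)) <= 1 / 2.
Proof.
move=> k0 K0; have k1 : 0 < k + 1 by rewrite ltr_wpDl.
have K1 : 0 < K + 1 by rewrite ltr_wpDl.
have D0 : 0 < 2 * (k + 1) * (K + 1) by rewrite !mulr_gt0.
exists (2 * (k + 1) * (K + 1))^-1.
  by rewrite invr_gt0 D0/= invf_le1//; have := mulr_ge0 k0 K0; nra.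
have -> : k * ((2 * (k + 1) * (K + 1))^-1 * (K + 1)) = k / (2 * (k + 1)).
  by field; rewrite !lt0r_neq0.
by rewrite ler_pdivrMr ?mulr_gt0//; lra.
Qed.

(** In a slice chart a zero [z] is compared with the point [w] of [M] having the same tangential
    coordinates. The chart difference [h] is purely normal, where [DF] composed with [Dg] is bounded
    below; but [F z = F w = 0] makes that image of [h] small compared with [h], so [h = 0]. *)
Lemma zero_set_near (R : realType) d j dM (F : 'cV[R]_d -> 'cV[R]_d) (O M : set
  'cV[R]_d) m :
  open O -> Ck 1 O F -> M `<=` O -> (forall z, M z -> F z = 0) ->
  (0 < j)%N -> submanifold j d dM M -> M m ->
  (forall v, jac F m *m v = 0 -> tangent M m v) ->
  \forall z \near m, F z = 0 -> M z.
Proof.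
move=> oO FC MO F0 j0 [_ /(_ m) sM] Mm kerF.
have [U [U' [f [g [[oU oU'] Um [fC gC] [fU gU' gfK fgK] fMU]]]]] := sM Mm.
have {}fC : Ck 1 U f by exact: Ck_le fC.
have {}gC : Ck 1 U' g by exact: Ck_le gC.
pose y0 := f m; pose P : 'M[R]_d := pid_mx dM.
have U'y0 : U' y0 by rewrite -fU; exists m.
have gy0 : g y0 = m by exact: gfK.
have slice w : M w -> U w -> forall i : 'I_d, (dM <= i)%N -> f w i 0 = 0.
  move=> Mw Uw; have : (f @` (M `&` U)) (f w) by exists w.
  by rewrite fMU => -[].
have Py0 : P *m y0 = y0.
  apply/colP => i; rewrite pid_mxE; case: ltnP => // di.
  by rewrite slice.
have dg : differentiable g y0 by case: gC => + _; apply.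
have df : differentiable f m by case: fC => + _; apply.
have dF : differentiable F m by case: FC => + _; apply; exact: MO.
(* [P *m h = 0] kills the tangential coordinates of [h]. If [Dg h] is in the kernel of [DF], it is
   the velocity of a curve in [M], whose normal chart coordinates vanish identically; so the normal
   coordinates of [h] vanish too. *)
have inj (h : 'cV[R]_d) : P *m h = 0 -> (jac F m *m jac g y0) *m h = 0 -> h = 0.
  move=> Ph; rewrite -mulmxA => /kerF[c [c0 cM cd]].
  have fgh : 'D_(jac g y0 *m h) f m = h.
    have H1 : is_derive (0 : R) 1 (fun s : R => f (g (y0 + s *: h))) ('D_(jac g
      y0 *m h) f m).
      have y00 : y0 + 0 *: h = y0 by rewrite scale0r addr0.
      rewrite -(derive_jac _ dg).
      have H2 : is_derive (0 : R) 1 (fun s : R => g (y0 + s *: h)) ('D_h g y0).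
        by rewrite -{2}y00; apply: is_derive_along; rewrite y00.
      have H3 : is_diff (g (y0 + 0 *: h)) f ('d f m).
        by rewrite y00 gy0; exact: differentiableP.
      by rewrite deriveE//; exact: (is_derive_comp_diff H2 H3).
    apply: is_derive_unique H1 _; apply: near_eq_is_derive (is_derive_line y0 h
      0).
    have : {for 0, continuous (fun s : R => y0 + s *: h)} by exact: cts_line.
    rewrite /prop_for /continuous_at scale0r addr0 => /(_ U') H.
    have {}H : \forall s \near (0 : R), U' (y0 + s *: h) by apply: H; exact:
      open_nbhs_nbhs.
    by apply: filterS H => s /fgK.
  apply/colP => i; rewrite mxE; have [idM|dMi] := ltnP i dM.
    by have := congr1 (fun u : 'cV[R]_d => u i 0) Ph; rewrite pid_mxE idM mxE.
  rewrite -fgh.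
  have H1 : is_diff (c 0) f ('d f m) by rewrite c0; exact: differentiableP.
  have H2 := is_derive_entry i 0 (is_derive_comp_diff cd H1).
  rewrite -deriveE// in H2.
  apply: is_derive_unique H2 _.
  apply: near_eq_is_derive (is_derive_cst (0 : R) (0 : R) 1).
  have : {for 0, continuous c} by exact: is_derive_cts cd.
  rewrite /prop_for /continuous_at c0 => /(_ U) H.
  have {}H : \forall s \near (0 : R), U (c s) by apply: H; exact:
    open_nbhs_nbhs.
  near=> s; rewrite /= slice//; [near: s; exact: cM|near: s; exact: H].
have [k k0 kP] := inj_lower_bound inj.
have [KF KF0 KFP] : exists2 KF : R, 0 <= KF & forall u : 'cV[R]_d, `|jac F m *m
  u| <= KF * `|u|.
  by exists (d%:R * `|jac F m|) => [|u]; [exact: mulr_ge0|exact: norm_mulmx_le].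
have [KG KG0 KGP] : exists2 KG : R, 0 <= KG & forall u : 'cV[R]_d, `|jac g y0
  *m u| <= KG * `|u|.
  by exists (d%:R * `|jac g y0|) => [|u]; [exact: mulr_ge0|exact:
    norm_mulmx_le].
have [e /andP[e0 e1] ke] := small_factor k0 (addr_ge0 KF0 KG0).
have [r1 r10 r1P] := C1_strict oU' gC U'y0 e0.
have [r2 r20 r2P] := C1_strict oO FC (MO _ Mm) e0.
have [q1 q10 q1P] := open_closed_ball oU' U'y0.
have [q2 q20 q2P] := cts_distP (differentiable_continuous dg) r20.
pose q := Num.min (Num.min r1 q1) q2.
have q0 : 0 < q by rewrite !lt_min r10 q10.
have [q3 q30 q3P] := cts_distP (differentiable_continuous df) q0.
have [q4 q40 q4P] := open_closed_ball oU Um.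
apply/nbhs_distP; exists (Num.min (Num.min q3 q4) r2); first by rewrite !lt_min
  q30 q40.
move=> z; rewrite !lt_min => /andP[/andP[zq3 zq4] zr2] Fz0.
have Uz : U z by apply/q4P/ltW.
(* Dropping the normal coordinates keeps the point close to [y0], since [P] fixes [y0] and does not
   increase the max norm. Hence [y'] is still in the chart and in the slice. *)
pose y := f z; pose y' := P *m y.
have yq : `|y - y0| < q by exact: q3P.
have y'q : `|y' - y0| < q.
  apply: le_lt_trans yq; rewrite -{1}Py0 /y' -mulmxBr; apply: mx_norm_le => //
    i l.
  rewrite ord1 pid_mxE; case: ifP => _; last by rewrite normr0.
  exact: ler_coord_norm.
move: yq y'q; rewrite !lt_min => /andP[/andP[yr1 yq1] yq2] /andP[/andP[y'r1
  y'q1] y'q2].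
have U'y' : U' y' by apply/q1P/ltW.
have [w [Mw Uw] fw] : (f @` (M `&` U)) y'.
  rewrite fMU; split=> // i di; rewrite pid_mxE ltnNge di//.
have gy' : g y' = w by rewrite -fw gfK.
have gy : g y = z by exact: gfK.
suff E : y - y' = 0 by rewrite -gy (subr0_eq E) gy'.
set h := y - y'.
have Ph : P *m h = 0.
  apply/colP => i; rewrite pid_mxE [RHS]mxE; case: ifP => // iM.
  by rewrite /h mxE [X in _ + X]mxE pid_mxE iM subrr.
have Hg : `|z - w - jac g y0 *m h| <= e * `|h|.
  by have := r1P _ _ yr1 y'r1; rewrite gy gy' derive_jac.
have HF : `|jac F m *m (z - w)| <= e * `|z - w|.
  have := r2P z w zr2 _; rewrite -gy' -{1 2}gy0.
  move=> /(_ (q2P _ y'q2)); rewrite gy' Fz0 (F0 _ Mw) subrr sub0r normrN.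
  by rewrite derive_jac ?gy0.
have Hw : `|z - w| <= (KG + 1) * `|h|.
  rewrite -[z - w](subrK (jac g y0 *m h)) addrC mulrDl mul1r.
  apply: le_trans (ler_normD _ _) _; apply: lerD; first exact: KGP.
  by apply: le_trans Hg _; rewrite ler_piMl.
(* One part of the error comes from [F] between [w] and [z], the other from [g] between [y'] and
   [y]. *)
have HN : `|jac F m *m jac g y0 *m h| <= e * (KF + KG + 1) * `|h|.
  have -> : jac F m *m jac g y0 *m h =
      jac F m *m (z - w) - jac F m *m (z - w - jac g y0 *m h).
    by rewrite -mulmxBr opprB addrC subrK mulmxA.
  apply: le_trans (ler_normB _ _) _.
  have -> : e * (KF + KG + 1) * `|h| = e * ((KG + 1) * `|h|) + KF * (e * `|h|)
    by ring.
  apply: lerD; first by apply: le_trans HF _; rewrite ler_wpM2l// ltW.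
  by apply: le_trans (KFP _) _; rewrite ler_wpM2l.
have hk := kP _ Ph.
have : `|h| <= k * (e * (KF + KG + 1)) * `|h|.
  by apply: le_trans hk _; rewrite -mulrA ler_wpM2l.
move=> hh; apply/eqP; rewrite -normr_le0.
have : `|h| <= 1 / 2 * `|h| by apply: le_trans hh _; rewrite ler_wpM2r.
lra.
Unshelve. all: by end_near. Qed.

Lemma min_hess_psd (R : realType) d (F : 'cV[R]_d -> 'cV[R]_d) (V : 'cV[R]_d ->
  R)
    (O : set 'cV[R]_d) m :
  open O -> O m -> Ck 1 O F -> F m = 0 -> V m = 0 ->
  (forall z, O z -> 0 <= V z) -> (forall z, O z -> is_diff z V (dot (F z))) ->
  forall y, 0 <= dot y (jac F m *m y).
Proof.
move=> oO Om FC Fm Vm V0 dV y; rewrite leNgt; apply/negP => a0.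
set a := dot y _ in a0.
have dF : differentiable F m by case: FC => + _; apply.
(* With this accuracy the linearization error of [dot F y] at [m + t *: y] is at most [- a / 4 * t],
   leaving a slope of at most [3 / 4 * a]. *)
pose e := - a / 4 / (d%:R * `|y| * `|y| + 1).
have D0 : 0 < d%:R * `|y| * `|y| + 1 by rewrite ltr_wpDl// !mulr_ge0.
have e0 : 0 < e by rewrite divr_gt0// divr_gt0// oppr_gt0.
have [r r0 rP] := C1_strict oO FC Om e0.
have [q q0 qP] := open_closed_ball oO Om.
pose s := Num.min r q / 2 / (`|y| + 1).
have y1 : 0 < `|y| + 1 by rewrite ltr_wpDl.
have mr : 0 < Num.min r q by rewrite lt_min r0.
have s0 : 0 < s by rewrite !divr_gt0.
have near_m t : 0 <= t <= s -> `|m + t *: y - m| < Num.min r q.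
  move=> /andP[t0 ts]; rewrite addrC addKr normrZ ger0_norm//.
  apply: (@le_lt_trans _ _ (s * (`|y| + 1))).
    by apply: ler_pM => //; rewrite lerDl.
  by rewrite /s divfK ?lt0r_neq0// ltr_pdivrMr// mulr_natr mulr2n ltrDl.
have Om_ t : 0 <= t <= s -> O (m + t *: y).
  by move=> /near_m; rewrite lt_min => /andP[_ /ltW]; exact: qP.
have Fm_ t : 0 <= t <= s -> dot (F (m + t *: y)) y <= t * a - t * a / 4.
  move=> ts; have := near_m _ ts; rewrite lt_min => /andP[tr _].
  have t0 : 0 <= t by case/andP: ts.
  have := rP _ m tr; rewrite subrr normr0 => /(_ r0).
  rewrite Fm subr0 (addrAC m) subrr add0r derive_jac// -scalemxAr.
  set E := _ - _ => HE.
  have -> : F (m + t *: y) = E + t *: (jac F m *m y) by rewrite /E subrK.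
  rewrite dotDl dotZl -/a [dot _ y]dotC [dot (_ *m _) y]dotC -/a addrC lerD2l.
  apply: le_trans (ler_norm _) _; apply: le_trans (norm_dot_le _ _) _.
  rewrite normrZ ger0_norm// in HE.
  apply: (@le_trans _ _ (d%:R * `|y| * (e * (t * `|y|)))); first by rewrite
    ler_wpM2l ?mulr_ge0.
  have -> : d%:R * `|y| * (e * (t * `|y|)) = t * (e * (d%:R * `|y| * `|y|)) by
    ring.
  have -> : - (t * a / 4) = t * (- a / 4) by field.
  rewrite ler_wpM2l//.
  apply: (@le_trans _ _ (e * (d%:R * `|y| * `|y| + 1))); first by rewrite
    ler_wpM2l ?lerDl// ltW.
  by rewrite /e divfK ?lt0r_neq0.
(* If [a < 0] then [h] is nonincreasing, so [V] is below [a / 4 * t ^+ 2]. *)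
pose h t := V (m + t *: y) - a / 4 * t ^+ 2.
have dh t : 0 <= t <= s -> is_derive t 1 h (dot (F (m + t *: y)) y - a / 2 * t).
  move=> ts; have H1 := is_derive_comp_along (dV _ (Om_ _ ts)).
  have H2 := is_deriveX 2 (is_derive_id t (1 : R)).
  apply: is_derive_eq (is_deriveB H1 (is_deriveZ (a / 4) H2)) _.
  have -> : (a / 4) *: (2 * t ^+ 2.-1)%:A = a / 2 * t.
    by rewrite /= expr1 -[_ *: _]/(a / 4 * (2 * t * 1)); field.
  by [].
have [||c] := @MVT_segment R h (fun t => dot (F (m + t *: y)) y - a / 2 * t) 0
  s (ltW s0).
- by move=> t; rewrite in_itv/= => /andP[t0 ts]; apply: dh; rewrite !ltW.
- apply: derivable_within_continuous => t; rewrite in_itv/= => ts.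
  by have [] := dh _ ts.
rewrite in_itv/= => cs; rewrite /h scale0r addr0 Vm expr0n/= mulr0 subr0 subr0
  subr0.
have := Fm_ _ cs; have := V0 _ (Om_ s _); rewrite (ltW s0) lexx => /(_ isT).
move: (V _) (dot _ _) => v f v0 fc E.
have c0 : 0 <= c by case/andP: cs.
have le0 : (f - a / 2 * c) * s <= 0.
  rewrite mulr_le0_ge0 ?(ltW s0)//.
  have : c * a <= 0 by rewrite mulr_ge0_le0// ltW.
  lra.
have : a / 4 * s ^+ 2 < 0.
  by rewrite nmulr_rlt0 ?exprn_gt0// pmulr_llt0.
lra.
Qed.

(** At [y + t *: w] the form equals [t * (2 * n + t * c)]. A small negative [t] makes this negative
    unless [n = 0]; dividing by [c + 1] covers the case [c = 0]. *)
Lemma psd_ker (R : realType) d (B : 'M[R]_d) y : B^T = B ->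
  (forall z, 0 <= dot z (B *m z)) -> dot y (B *m y) = 0 -> B *m y = 0.
Proof.
move=> BT Bp y0; set w := B *m y; apply: dot_eq0.
pose c := dot w (B *m w); have c0 : 0 <= c by exact: Bp.
have n0 := dot_ge0 w; set n := dot w w in n0 *.
pose t := - (n / (c + 1)); have c1 : 0 < c + 1 by rewrite ltr_wpDl.
have := Bp (y + t *: w).
rewrite mulmxDr -scalemxAr !dotDl !dotDr !dotZl !dotZr y0 -/w -/n -/c.
have -> : dot y (B *m w) = n by rewrite -BT -dot_trmxl.
rewrite add0r => H; apply/eqP; rewrite eq_le n0 andbT leNgt; apply/negP => np.
have t0 : t < 0 by rewrite oppr_lt0 divr_gt0.
have tc : t * (c + 1) = - n by rewrite /t mulNr divfK ?lt0r_neq0.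
have {}H : n + (n + t * c) <= 0 by rewrite -(nmulr_rge0 _ t0) !mulrDr.
rewrite mulrDr mulr1 in tc; move: (t * c) H tc => u H tc.
clearbody t n; clear -H tc t0 np; lra.
Qed.

Lemma sub_cts (R : realType) (T : topologicalType) (V : normedModType R)
    (f : T -> V) (c : V) t :
  {for t, continuous f} -> {for t, continuous (fun s => f s - c)}.
Proof. by move=> cf; apply: cvgB; [exact: cf|exact: cvg_cst]. Qed.

Lemma ge0_integral_Ny_eq0 (R : realType) (f : R -> R) (T : R) :
  (forall t, t <= T -> {for t, continuous f}) -> (forall t, t <= T -> 0 <= f t)
    ->
  (\int[lebesgue_measure]_(t in `]-oo, T]) (f t)%:E = 0)%E ->
  forall t, t <= T -> f t = 0.
Proof.
move=> cf f0 If t tT; apply/eqP; rewrite eq_le (f0 _ tT) andbT leNgt;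
  apply/negP => ft.
have f2 : 0 < f t / 2 by rewrite divr_gt0.
have [r r0 rP] := cts_distP (cf _ tT) f2.
(* The interval lies to the left of [t] because [t] may be the right end [T]. On it [f] is at least
   [f t / 2], so the integral is at least the area of a rectangle. *)
pose u := t - r / 2; have r2 : 0 < r / 2 by rewrite divr_gt0.
have ut : u <= t by rewrite /u; lra.
have I0 (D : interval R) : (forall s, s \in D -> s <= T) ->
    (0 <= \int[lebesgue_measure]_(s in [set` D]) (f s)%:E)%E.
  by move=> DT; apply: integral_ge0 => s /DT sT; rewrite lee_fin f0.
have : (\int[lebesgue_measure]_(s in `[u, t]) (f s)%:E <= 0)%E.
  rewrite -If (ge0_integral_Ny_cat tT cf f0).
  rewrite (@ge0_integral_Ny_cat _ _ u t ut).
  - rewrite -addeA addeCA leeDl// adde_ge0// I0// => s; rewrite in_itv/=.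
      by move=> su; apply: le_trans su (le_trans ut tT).
    by case/andP.
  - by move=> s st; apply: cf; exact: le_trans tT.
  - by move=> s st; apply: f0; exact: le_trans tT.
apply/negP; rewrite -ltNge.
have E : (\int[lebesgue_measure]_(s in `[u, t]) (f t / 2)%:E = (f t / 2 * (r /
  2))%:E)%E.
  apply: (@FTC2_is_derive _ (fun s => f t / 2 * s) (fun=> f t / 2)) => //.
  - move=> s _.
    have H := is_deriveZ (f t / 2) (is_derive_id s (1 : R)).
    by apply: is_derive_eq H _; exact: mulr1.
  - by move=> s _; exact: cst_continuous.
  - by rewrite -mulrBr /u opprB addrC subrK.
apply: (@lt_le_trans _ _ (f t / 2 * (r / 2))%:E); first by rewrite lte_fin
  mulr_gt0.
rewrite -E; apply: ge0_le_integral => //.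
- by move=> s _; rewrite lee_fin ltW.
- apply/measurable_realfun.measurable_EFinP.
  apply: measurable_realfun.subspace_continuous_measurable_fun => //.
  apply: continuous_in_subspaceT => s; rewrite inE/= in_itv/= => /andP[_ st].
  by apply: cf; exact: le_trans tT.
- move=> s; rewrite /= in_itv/= => /andP[us st]; rewrite lee_fin.
  have /rP : `|s - t| < r by rewrite ltr_norml; apply/andP; split; move: us;
    rewrite /u; lra.
  by rewrite ltr_norml => /andP[h _]; lra.
Qed.

(** * Orbits on the unstable manifold *)

Lemma near_eq_jac (R : realType) d e (f g : 'cV[R]_d -> 'cV[R]_e) (x :
  'cV[R]_d) :
  (\forall y \near x, f y = g y) -> jac f x = jac g x.
Proof.
have D (V W : normedModType R) (p q : V -> W) z v :
    (\forall y \near z, p y = q y) -> 'D_v p z = 'D_v q z.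
  exact: near_eq_derive.
move=> fg; apply/matrixP => i j.
by rewrite [LHS]mxE [RHS]mxE (D _ _ f g x (evec j) fg).
Qed.

Section UnstableData.
Context (R : realType) (d : nat) (Omega : set 'cV[R]_d)
  (b : 'cV[R]_d -> 'cV[R]_d) (A : 'cV[R]_d -> 'M[R]_d)
  (M : set 'cV[R]_d) (S : 'cV[R]_d -> {vspace 'cV[R]_d})
  (k dM k' : nat) (beta0 betas : R)
  (Wu : set ('cV[R]_d * 'cV[R]_d)) (Wx : 'cV[R]_d -> set ('cV[R]_d * 'cV[R]_d))
  (O0 : set 'cV[R]_d) (F : 'cV[R]_d -> 'cV[R]_d) (O1 : set 'cV[R]_d).
Context (oOmega : open Omega) (b2 : Ck 2 Omega b) (A2 : Ck 2 Omega A)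
  (A_sympos : forall x, Omega x -> sympos (A x))
  (k_gt0 : (0 < k)%N) (ncimM : ncim k Omega b M dM S beta0 betas k')
  (data : unstable_data Omega b A M S betas k' Wu Wx O0 F O1).
Local Notation Z := (fun y t => Hflow Omega b A t (y, F y)).

Lemma field_loclip z : Hdom Omega z -> loclip (Hfield b A) z.
Proof. exact: Hfield_loclip. Qed.

Lemma O1_sub : O1 `<=` O0.
Proof. by move=> x O1x; apply: (ud_O1_O0 data).2; exact: subset_closure. Qed.

Lemma M_sub_O0 : M `<=` O0.
Proof. by move=> x /(ud_M_O1 data)/O1_sub. Qed.

Lemma graph_Wu x : O0 x -> Wu (x, F x).
Proof.
move=> Ox; have : graph_on O0 F (x, F x) by exists x.
by rewrite (ud_graph data) => -[].
Qed.

(** Orbits start over [O1] and are only known to remain over the larger [O0], which is why bounds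
    and primitives are taken on [O0]. *)
Lemma orbit_graph y (t : R) : O1 y -> t <= 0 ->
  [/\ flow_dom (Hfield b A) (Hdom Omega) t (y, F y), O0 (Z y t).1,
      (Z y t).2 = F (Z y t).1, Z y 0 = (y, F y) &
      is_derive t 1 (Z y) (Hfield b A (Z y t))].
Proof.
move=> O1y t0; have [H1 H2] := ud_graph_inv data t0.
have yG : graph_on O1 F (y, F y) by exists y.
have D := H1 _ yG; have [Z0 _ dZ] := flow_sol field_loclip D.
have [x Ox xE] : graph_on O0 F (Z y t) by apply: H2; exists (y, F y).
by split=> //; rewrite -xE.
Qed.

Lemma orbit_start y : O1 y -> Z y 0 = (y, F y).
Proof. by move=> O1y; have [] := orbit_graph O1y (lexx 0). Qed.

Lemma orbit_O0 y (t : R) : O1 y -> t <= 0 -> O0 (Z y t).1.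
Proof. by move=> O1y t0; have [] := orbit_graph O1y t0. Qed.

Lemma betas_half : 0 < betas / 2 < betas.
Proof.
have /andP[h1 h2] := ncim_rates ncimM; have h3 := lt_trans h1 h2.
by rewrite divr_gt0// ltr_pdivrMr// mulr_natr mulr2n ltrDl.
Qed.

Lemma leaf_proj_M z : Wu z -> M (leaf_proj M Wx z).
Proof.
move=> Wz; have : exists x, M x /\ Wx x z.
  by move: Wz; rewrite (ud_cover data) => -[x Mx xz]; exists x.
move=> [x Hx].
by have [] := @xgetPex _ 0 [set x | M x /\ Wx x z] (ex_intro _ x Hx).
Qed.

Lemma leaf_proj_base m : M m -> leaf_proj M Wx (m, F m) = m.
Proof.
move=> Mm; rewrite (ud_F0 data Mm).
have Hm : M m /\ Wx m (m, 0) by split=> //; exact: (ud_leaf_base data).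
have [Mp Wp] := @xgetPex _ 0 [set x | M x /\ Wx x (m, 0)] (ex_intro _ m Hm).
by apply: (ud_disjoint data) => //; exists (m, 0); split => //; case: Hm.
Qed.

Lemma flow_M m (t : R) : M m -> M (flow b Omega t m).
Proof.
by move=> Mm; have [_ <-] := ncim_inv ncimM t; exists m.
Qed.

(** Continuity on the open set [O0] gives no bound up to its boundary. The decay estimate at time 0
    does, since it bounds the distance from [(x, F x)] to the zero section. *)
Lemma F_bounded : exists2 C : R, 0 <= C & forall x, O0 x -> `|F x| <= C.
Proof.
have [C [C0 H]] := ud_decay data betas_half.
exists C; [exact: ltW|move=> x Ox].
have Wz := graph_Wu Ox.
have [D _] := ud_inv data (lexx 0).
have [Z0 _ _] := flow_sol field_loclip (D _ Wz).
have := H _ Wz 0 (lexx 0); rewrite /Hflow Z0 mulr0 expR0 mulr1.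
move/(le_trans (norm_le_enorm2 _))/(le_trans (norm_snd_le _)).
by rewrite /= subr0.
Qed.

Lemma orbit_to_M (e : R) : 0 < e -> exists2 T : R, T <= 0 &
  forall y (t : R), O1 y -> t <= T -> exists2 m, M m & `|(Z y t).1 - m| < e.
Proof.
move=> e0; have [C [C0 H]] := ud_decay data betas_half.
have /andP[bh _] := betas_half.
(* The time at which the decay bound [C * expR (betas / 2 * t)] drops to [e / 2]. *)
exists (Num.min 0 (ln (e / (2 * C)) / (betas / 2))); first by rewrite ge_min
  lexx.
move=> y t O1y; rewrite le_min => /andP[t0 tl].
have Wz := graph_Wu (O1_sub O1y).
exists (flow b Omega t (leaf_proj M Wx (y, F y))).
  exact/flow_M/leaf_proj_M.
have := H _ Wz t t0.
move/(le_trans (norm_le_enorm2 _))/(le_trans (norm_fst_le _)) => /= h.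
apply: le_lt_trans h _.
apply: (@le_lt_trans _ _ (C * (e / (2 * C)))).
  rewrite ler_wpM2l ?(ltW C0)// -[leRHS]lnK ?posrE ?divr_gt0 ?mulr_gt0//.
  by rewrite ler_expR mulrC -ler_pdivlMr.
have -> : C * (e / (2 * C)) = e / 2 by field; rewrite lt0r_neq0.
by rewrite ltr_pdivrMr// mulr_natr mulr2n ltrDl.
Qed.

Lemma F_C1 : Ck 1 O0 F.
Proof. by apply: Ck_le (ud_F data); case/andP: (ncim_k' ncimM). Qed.

Lemma F_diff x : O0 x -> differentiable F x.
Proof. by move=> Ox; have [+ _] := F_C1; exact. Qed.

(** Backward orbits from [O1] stay in the compact set [K], with positions in the closure of [O0] and
    momenta bounded by [F_bounded]. One Lipschitz constant on [K], hence one Gronwall factor [E],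
    works for all times in [[T, 0]]. *)
Lemma orbit_dependence x (T e : R) : O1 x -> T <= 0 -> 0 < e ->
  \forall y \near x, forall t : R, T <= t <= 0 -> `|(Z y t).1 - (Z x t).1| < e.
Proof.
move=> O1x T0 e0; have [C C0 FC] := F_bounded.
have [cK KOm] := ud_O0_Omega data.
pose K : set ('cV[R]_d * 'cV[R]_d) := closure O0 `*` [set p | `|p - 0| <= C].
have KC : compact K by apply: compact_setX => //; exact: compact_ball_le.
have [L L0 LP] := compact_lipschitz KC (fun z Kz => field_loclip (conj (KOm _
  Kz.1) I)).
have orbK y (t : R) : O1 y -> t <= 0 -> K (Z y t) /\ is_derive t 1 (Z y)
  (Hfield b A (Z y t)).
  move=> O1y t0; have [_ O0z zF _ dZ] := orbit_graph O1y t0; split=> //.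
  by split; [exact: subset_closure|rewrite /= subr0 zF; exact: FC].
pose E := expR (4 * d%:R * L * (0 - T)).
have E0 : 0 < E by exact: expR_gt0.
pose q y := qnorm ((y, F y) - (x, F x)).
have cF := differentiable_continuous (F_diff (O1_sub O1x)).
have cq : {for x, continuous q}.
  have c1 : {for x, continuous (fun y : 'cV[R]_d => y - x)} by exact: sub_cts.
  have c2 : {for x, continuous (fun y => F y - F x)} by exact: sub_cts.
  exact: (cvgD (cts_dot c1 c1) (cts_dot c2 c2)).
have q0 : q x = 0 by rewrite /q subrr /qnorm/= dot0l addr0.
(* [qnorm] is a squared norm, hence the square of [e]; [E] absorbs the Gronwall growth. *)
have e2 : 0 < e ^+ 2 / E by rewrite divr_gt0// exprn_gt0.
have [r r0 rP] := cts_distP cq e2.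
have nO1 : \forall y \near x, O1 y by apply: open_nbhs_nbhs; split=> //; exact:
  (ud_open1 data).
have nr : \forall y \near x, `|y - x| < r by apply/nbhs_distP; exists r.
near=> y; move=> t /andP[Tt t0].
have O1y : O1 y by near: y.
have := rP y; rewrite q0 subr0 => /(_ _) qy.
have {}qy : q y < e ^+ 2 / E by apply: le_lt_trans (ler_norm _) (qy _); near: y.
have [] := @gronwall_sol _ _ (Hfield b A) K L t 0 (Z y) (Z x) t0 L0 LP.
- by move=> s /andP[_ s0]; exact: orbK.
- by move=> s /andP[_ s0]; exact: orbK.
move=> _; have [_ _ _ -> _] := orbit_graph O1y (lexx 0).
have [_ _ _ -> _] := orbit_graph O1x (lexx 0).
move=> H; rewrite -(@ltr_pXn2r _ 2%N) ?nnegrE ?(ltW e0)//.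
apply: (@le_lt_trans _ _ (`|Z y t - Z x t| ^+ 2)).
  by rewrite ler_pXn2r ?nnegrE//; exact: (norm_fst_le (Z y t - Z x t)).
apply: le_lt_trans (sqr_norm_le_qnorm _) _; apply: le_lt_trans H _.
apply: (@le_lt_trans _ _ (E * q y)).
  by rewrite ler_wpM2r ?qnorm_ge0// ler_expR ler_wpM2l ?mulr_ge0// lerB.
by rewrite mulrC -ltr_pdivlMr.
Unshelve. all: by end_near. Qed.

(** * Symmetry and kernel of the derivative of [F] *)

Lemma tangent_Wu x v : O0 x -> tangent Wu (x, F x) (v, 'D_v F x).
Proof.
move=> Ox; apply: (tangent_graph _ (ud_open0 data)) => //; first exact: F_diff.
by move=> _ [y Oy <-]; exact: graph_Wu.
Qed.

(** The symplectic form on the graph tangents [(u, DF u)] and [(v, DF v)] is the antisymmetric part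
    of [DF]. *)
Lemma F_closed x : O0 x -> forall u v, dot ('D_u F x) v = dot ('D_v F x) u.
Proof.
move=> Ox u v.
have := ud_lagr data (graph_Wu Ox) (tangent_Wu u Ox) (tangent_Wu v Ox).
by move=> /= /eqP; rewrite subr_eq0 => /eqP E; rewrite dotC -E dotC.
Qed.

Lemma jacF_sym x : O0 x -> (jac F x)^T = jac F x.
Proof.
move=> Ox; apply/matrixP => i j; rewrite !mxE.
have := F_closed Ox (evec i) (evec j); rewrite !dotE.
rewrite (bigD1 j)//= big1 ?addr0; last first.
  by move=> l lj; rewrite [evec j l 0]mxE (negbTE lj) mulr0.
rewrite (bigD1 i)//= big1 ?addr0; last first.
  by move=> l li; rewrite [evec i l 0]mxE (negbTE li) mulr0.
by rewrite [evec j j 0]mxE [evec i i 0]mxE !eqxx !mulr1.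
Qed.

(* [(v, DF v)] is tangent to [W^u], hence equals [(Q q, q) + (u, 0)] with [u]
   tangent to [M]. *)
Lemma jacF_ker m v : M m -> jac F m *m v = 0 -> tangent M m v.
Proof.
move=> Mm Fv; have Om := M_sub_O0 Mm.
have := tangent_Wu v Om; rewrite (derive_jac _ (F_diff Om)) Fv (ud_F0 data Mm).
have [-> _] := ud_tangent data Mm.
move=> [[u1 u2] [q [q' qE] [<- <-]]] [[w1 w2] [c [c0 cM cd]] [E1 E2]].
have w20 : w2 = 0.
  apply: (is_derive_unique (is_derive_snd cd)).
  apply: near_eq_is_derive (is_derive_cst (0 : 'cV[R]_d) (0 : R) 1).
  by apply: filterS cM => s [_ /= ->].
move: E2; rewrite /= w20 addr0 => q0; move: E1; rewrite /= q0 mulmx0 add0r =>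
  <-.
exists (fun s => (c s).1); split; first by rewrite c0.
  by apply: filterS cM => s [].
exact: (is_derive_fst cd).
Qed.

Lemma O0_Omega : O0 `<=` Omega.
Proof. by move=> x Ox; apply: (ud_O0_Omega data).2; exact: subset_closure. Qed.

(** * The running cost along an orbit *)

Local Notation X := (fun y t => (Z y t).1).
Local Notation X' := (fun y t => (Hfield b A (Z y t)).1).

Lemma orbit_energy y (t : R) : O1 y -> t <= 0 ->
  dot (F (X y t)) (X' y t) = bilin (A (X y t)) (F (X y t)) (F (X y t)).
Proof.
move=> O1y t0; have [_ O0z zF _ _] := orbit_graph O1y t0.
rewrite /Hfield/= zF; have := ud_H0 data O0z; rewrite /Ham.
rewrite dotDr dotZr -bilinE [dot (b _) _]dotC => H.
by rewrite mulr_natl mulr2n -addrA H addr0.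
Qed.

Lemma orbit_deriv y (t : R) : O1 y -> t <= 0 -> is_derive t 1 (X y) (X' y t).
Proof.
by move=> O1y t0; have [_ _ _ _ dZ] := orbit_graph O1y t0; exact: is_derive_fst
  dZ.
Qed.

Lemma running_costE y (t : R) : O1 y -> t <= 0 ->
  running_cost Omega b A F y t = bilin (A (X y t)) (F (X y t)) (F (X y t)).
Proof.
move=> O1y t0; have [_ O0z zF _ _] := orbit_graph O1y t0.
rewrite /running_cost derive1E; have [_ ->] := orbit_deriv O1y t0.
rewrite /Hfield/= zF; apply: Lag_Hvel; exact/A_sympos/O0_Omega.
Qed.

Lemma bilinA_ge0 x p : Omega x -> 0 <= bilin (A x) p p.
Proof.
move=> /A_sympos[_ H]; have [->|/H/ltW//] := eqVneq p 0.
by rewrite bilin0r.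
Qed.

Lemma orbit_cost_ge0 y (t : R) : O1 y -> t <= 0 -> 0 <= dot (F (X y t)) (X' y
  t).
Proof.
move=> O1y t0; rewrite orbit_energy//; apply/bilinA_ge0/O0_Omega.
by have [] := orbit_graph O1y t0.
Qed.

Lemma orbit_cost_cts y (t : R) : O1 y -> t <= 0 ->
  {for t, continuous (fun t => dot (F (X y t)) (X' y t))}.
Proof.
move=> O1y t0; have [_ O0z _ _ dZ] := orbit_graph O1y t0.
have cZ := is_derive_cts dZ.
have cX := is_derive_cts (orbit_deriv O1y t0).
have cH := loclip_cts (field_loclip (conj (O0_Omega O0z) I : Hdom Omega (Z y
  t))).
apply: cts_dot; first exact: (continuous_comp cX (differentiable_continuous
  (F_diff O0z))).
apply: (@continuous_comp _ _ _ (fun s => Hfield b A (Z y s)) fst); last exact: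
  cvg_fst.
exact: (continuous_comp cZ cH).
Qed.

Lemma value_local x : O1 x -> exists G : 'cV[R]_d -> R, is_diff x G (dot (F x))
  /\
  \forall y \near x, (\int[lebesgue_measure]_(t in `]-oo, 0%R])
    (running_cost Omega b A F y t)%:E)%E = (G y)%:E.
Proof.
move=> O1x.
pose p z := leaf_proj M Wx (z, F z).
have dp z : O0 z -> differentiable p z.
  move=> Oz; have : Ck 1 O0 p by apply: Ck_le (ud_pi data); case/andP: (ncim_k'
    ncimM).
  by case=> + _; exact.
have WM m (Mm : M m) := near_potential (ud_open0 data) F_C1 M_sub_O0 F_closed
  (ud_F0 data) leaf_proj_base (fun z Oz => leaf_proj_M (graph_Wu Oz)) dp Mm.
have [G [dG GV]] := @value_grad _ _ F O0 O1 M _ X X' (ud_open0 data) (ud_open1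
  data)
  F_C1 F_closed (ncim_compact ncimM) WM (fun y O1y => congr1 fst (orbit_start
    O1y))
  orbit_O0 orbit_deriv orbit_cost_ge0 orbit_cost_cts orbit_dependence
    orbit_to_M _ O1x.
exists G; split=> //.
have nO1 : \forall y \near x, O1 y by apply: open_nbhs_nbhs; split=> //; exact:
  (ud_open1 data).
near=> y; have O1y : O1 y by near: y.
have <- : (\int[lebesgue_measure]_(t in `]-oo, 0%R]) (dot (F (X y t)) (X' y
  t))%:E)%E
   = (G y)%:E by near: y; exact: GV.
apply: eq_integral => t; rewrite inE/= in_itv/= => t0.
by rewrite orbit_energy// running_costE.
Unshelve. all: by end_near. Qed.

(** * The value function: regularity, zeros and Hessian *)

Local Notation V := (Vhat Omega b A F).

Lemma value_fin x : O1 x ->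
  (\int[lebesgue_measure]_(t in `]-oo, 0%R]) (running_cost Omega b A F x
    t)%:E)%E = (V x)%:E.
Proof.
by move=> /value_local[G [_ /nbhs_singleton E]]; rewrite /Vhat /Rintegral E.
Qed.

Lemma value_diff x : O1 x -> is_diff x V (dot (F x)).
Proof.
move=> /value_local[G [dG GV]]; apply: near_eq_is_diff dG.
by apply: filterS GV => y; rewrite /Vhat /Rintegral => ->.
Qed.

Lemma running_cost_ge0 x (t : R) : O1 x -> t <= 0 -> 0 <= running_cost Omega b
  A F x t.
Proof.
by move=> O1x t0; rewrite running_costE// -orbit_energy// orbit_cost_ge0.
Qed.

Lemma running_cost_measurable x : O1 x ->
  measurable_fun `]-oo, (0 : R)] (running_cost Omega b A F x).
Proof.
move=> O1x; apply: (eq_measurable_fun (fun t => dot (F (X x t)) (X' x t))).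
  by move=> t; rewrite inE/= in_itv/= => t0; rewrite orbit_energy//
    running_costE.
apply: measurable_realfun.subspace_continuous_measurable_fun => //.
apply: continuous_in_subspaceT => t; rewrite inE/= in_itv/= => t0.
exact: orbit_cost_cts.
Qed.

Lemma running_cost_integrable x : O1 x ->
  lebesgue_measure.-integrable `]-oo, (0 : R)]
    (fun t => (running_cost Omega b A F x t)%:E).
Proof.
move=> O1x; apply/integrableP; split.
  apply/measurable_realfun.measurable_EFinP; exact: running_cost_measurable.
rewrite (_ : integral _ _ _ = (V x)%:E) ?ltry// -value_fin//.
apply: eq_integral => t; rewrite inE/= in_itv/= => t0.
by rewrite ger0_norm// running_cost_ge0.
Qed.

Lemma value_ge0 x : O1 x -> 0 <= V x.
Proof.
move=> O1x; rewrite -lee_fin -value_fin//; apply: integral_ge0 => t /=.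
by rewrite in_itv/= => t0; rewrite lee_fin running_cost_ge0.
Qed.

Lemma value_M x : M x -> V x = 0.
Proof.
move=> Mx; have O1x := ud_M_O1 data Mx.
rewrite /Vhat /Rintegral integral0_eq// => t /=; rewrite in_itv/= => t0.
rewrite running_costE//.
have [D _] := ncim_inv ncimM t; have [y xy] := D _ Mx.
have E : Z x t = (y, 0).
  by rewrite (ud_F0 data Mx); exact: (flow_relP field_loclip (flow_rel_lift A
    xy)).
by have [_ _ zF _ _] := orbit_graph O1x t0; rewrite -zF E bilin0r.
Qed.

Lemma value_eq0 x : O1 x -> V x = 0 -> M x.
Proof.
move=> O1x V0.
have P0 (t : R) : t <= 0 -> F (X x t) = 0.
  move=> t0.
  have L0 : dot (F (X x t)) (X' x t) = 0.
    apply: (@ge0_integral_Ny_eq0 _ (fun t => dot (F (X x t)) (X' x t)) 0 _ _ _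
      t t0).
    - by move=> s; exact: orbit_cost_cts.
    - by move=> s; exact: orbit_cost_ge0.
    transitivity (V x)%:E; last by rewrite V0.
    rewrite -value_fin//; apply: eq_integral => s; rewrite inE/= in_itv/= => s0.
    by rewrite orbit_energy// running_costE.
  apply: contrapT => /eqP Fn0.
  have [_ H] := A_sympos (O0_Omega (orbit_O0 O1x t0)).
  by have := H _ Fn0; rewrite -orbit_energy// L0 ltxx.
have [e e0 eP] := compact_uniform_near (ncim_compact ncimM)
  (fun m Mm => zero_set_near (ud_open0 data) F_C1 M_sub_O0 (ud_F0 data) k_gt0
     (ncim_mfd ncimM) Mm (fun v => jacF_ker Mm)).
have [T T0 TP] := orbit_to_M e0.
have [m Mm me] := TP x T O1x (lexx T).
have MX : M (X x T) := eP _ _ Mm me (P0 _ T0).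
have ZT : Z x T = (X x T, 0).
  by have [_ _ zF _ _] := orbit_graph O1x T0; rewrite -(P0 _ T0) -zF
    -surjective_pairing.
(* The base flow carries [X x T] forward for time [- T] to some [y], which lies in [M] by
   invariance; it remains to identify [y] with [x]. *)
have [D _] := ncim_inv ncimM (- T); have [y yx] := D _ MX.
suff yE : y = x by rewrite -yE -(flow_base field_loclip yx); exact: flow_M.
have NT0 : 0 <= - T by rewrite oppr_ge0.
have Zx0 : Z x (T + - T *: 1) = (x, 0).
  rewrite -[- T *: 1]/(- T * 1) mulr1 subrr orbit_start//.
  by have := P0 0 (lexx 0); rewrite orbit_start// => ->.
have [l [u [c [lu tu c0 cy cP]]]] := flow_rel_lift A yx.
suff : c (- T) = Z x (T + - T *: 1) by rewrite cy Zx0 => -[].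
(* The base orbit lifted with zero momentum and the orbit of [(x, F x)] shifted by [T] solve the
   same system from the same point. The shift is written [T + s *: 1] to match
   [is_derive_line_gateaux]. *)
apply: (sol_unique (s := - T) (c2 := fun s => Z x (T + s *: 1)) field_loclip).
- by rewrite c0 scale0r addr0 ZT.
- by move=> s /(itv_min_max_ind lu tu); exact: cP.
- move=> s; rewrite (min_l NT0) (max_r NT0) => /andP[s0 sT].
  have Ts : T + s *: 1 <= 0 by rewrite -[s *: 1]/(s * 1) mulr1; lra.
  have [_ O0z _ _ dZ] := orbit_graph O1x Ts.
  split; first by split => //; exact: O0_Omega.
  exact: (@is_derive_line_gateaux _ _ _ (Z x) T 1 s).
Qed.

Lemma value_derive x v : O1 x -> 'D_v V x = dot (F x) v.
Proof. by move=> /value_diff[dV E]; rewrite deriveE// E. Qed.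

Lemma value_grad_F x : O1 x -> grad V x = F x.
Proof.
move=> O1x; apply/colP => i; rewrite mxE value_derive// dotE (bigD1 i)//= big1
  ?addr0.
  by rewrite mxE !eqxx mulr1.
by move=> l li; rewrite [evec i l 0]mxE (negbTE li) mulr0.
Qed.

(** Each directional derivative of [V] is a linear image of [F], so [V] gains one degree over the
    C^k' map [F]. *)
Lemma value_Ck : Ck k'.+1 O1 V.
Proof.
split=> [x /value_diff[]//|v].
have lin_dot : linear (fun p : 'cV[R]_d => dot p v) by move=> a p q; rewrite
  dotDl dotZl.
pose dotM := GRing.isLinear.Build _ _ _ _ _ lin_dot.
pose L : {linear 'cV[R]_d -> R} := HB.pack (fun p : 'cV[R]_d => dot p v) dotM.
have cL : continuous L by move=> p; apply: cts_dot; [exact: cvg_id|exact: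
  cst_continuous].
have oO1 := ud_open1 data.
apply: (Ck_eq oO1) (Ck_linear oO1 cL (Ck_sub O1_sub (ud_F data))) => x O1x.
by rewrite value_derive.
Qed.

Lemma value_hess x : O1 x -> hess V x = jac F x.
Proof.
move=> O1x; apply: near_eq_jac.
have : \forall y \near x, O1 y by apply: open_nbhs_nbhs; split=> //; exact:
  (ud_open1 data).
by apply: filterS => y /value_grad_F.
Qed.

Lemma value_hess_ge0 x y : M x -> 0 <= bilin (hess V x) y y.
Proof.
move=> Mx; have O1x := ud_M_O1 data Mx; rewrite value_hess// bilinE.
apply: (min_hess_psd (ud_open1 data) O1x (Ck_sub O1_sub F_C1) (ud_F0 data Mx)
  (value_M Mx)).
  exact: value_ge0.
exact: value_diff.
Qed.

Lemma value_hess_tangent x y z : M x -> tangent M x y \/ tangent M x z ->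
  bilin (hess V x) y z = 0.
Proof.
move=> Mx; have O1x := ud_M_O1 data Mx; rewrite value_hess// bilinE.
case=> H; last by rewrite (ud_dF_tangent data Mx H) dot0r.
by rewrite -(jacF_sym (M_sub_O0 Mx)) -dot_trmxl (ud_dF_tangent data Mx H) dot0l.
Qed.

(** For a semi-definite symmetric matrix a zero of the form is a kernel vector. Here it is tangent
    to [M] by [jacF_ker], and being also orthogonal to the tangent space it is 0. *)
Lemma value_hess_gt0 x y : M x -> y != 0 -> (forall v, tangent M x v -> dot y v
  = 0) ->
  0 < bilin (hess V x) y y.
Proof.
move=> Mx yn0 yT; rewrite lt_neqAle value_hess_ge0// andbT eq_sym.
apply: contra yn0 => /eqP y0.
have O1x := ud_M_O1 data Mx; rewrite value_hess// bilinE in y0.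
have psd z : 0 <= dot z (jac F x *m z).
  by rewrite -bilinE -value_hess//; exact: value_hess_ge0.
have Fy := psd_ker (jacF_sym (M_sub_O0 Mx)) psd y0.
by apply/eqP/dot_eq0/yT/jacF_ker.
Qed.

End UnstableData.

Unset Implicit Arguments.

Theorem corollary3p1 (R : realType) (d k : nat) (Omega : set 'cV[R]_d)
    (b : 'cV[R]_d -> 'cV[R]_d) (A : 'cV[R]_d -> 'M[R]_d)
    (Omega_open : open Omega) (Omega_connected : connected Omega)
    (k_gt2 : (2 < k)%N) (b_Ck : Ck k Omega b) (A_Ck : Ck k.+1 Omega A)
    (A_sympos : forall x, Omega x -> sympos (A x))
    (M : set 'cV[R]_d) (dM : nat) (S : 'cV[R]_d -> {vspace 'cV[R]_d})
    (beta0 betas : R) (k' : nat)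
    (M_ncim : ncim k Omega b M dM S beta0 betas k')
    (Wu : set ('cV[R]_d * 'cV[R]_d))
    (Wx : 'cV[R]_d -> set ('cV[R]_d * 'cV[R]_d))
    (O0 : set 'cV[R]_d) (F : 'cV[R]_d -> 'cV[R]_d) (O1 : set 'cV[R]_d)
    (data : unstable_data Omega b A M S betas k' Wu Wx O0 F O1)
    (k'_ge2 : (2 <= k')%N) :
  let V := Vhat Omega b A F in
  (forall x, O1 x ->
     (forall t : R, t <= 0 ->
        flow_dom (Hfield b A) (Hdom Omega) t (x, F x) /\
        derivable (fun s : R => (Hflow Omega b A s (x, F x)).1) t 1) /\
     lebesgue_measure.-integrable `]-oo, (0 : R)]
       (fun t => (running_cost Omega b A F x t)%:E)) /\
  (forall x, O1 x -> 0 <= V x) /\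
  (forall x, O1 x -> (V x = 0 <-> M x)) /\
  (Ck k'.+1 O1 V /\ forall x, O1 x -> grad V x = F x) /\
  (forall x, O1 x -> Ham b A x (grad V x) = 0) /\
  (forall x, M x ->
     [/\ forall y, 0 <= bilin (hess V x) y y,
         forall y z, tangent M x y \/ tangent M x z -> bilin (hess V x) y z = 0
       & forall y, y != 0 -> (forall v, tangent M x v -> dot y v = 0) ->
           0 < bilin (hess V x) y y]).
Proof.
have b2 : Ck 2 Omega b by apply: Ck_le b_Ck; exact: ltnW.
have A2 : Ck 2 Omega A by apply: Ck_le A_Ck; exact: leq_trans (ltnW k_gt2) _.
have k0 : (0 < k)%N by exact: leq_trans k_gt2.
move=> V; split.
  move=> x O1x; split; last exact: (running_cost_integrable Omega_open b2 A2
    A_sympos M_ncim data).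
  move=> t t0; split; first by have [] := orbit_graph Omega_open b2 A2 data O1x
    t0.
  by have [] := orbit_deriv Omega_open b2 A2 data O1x t0.
split; first by move=> x; exact: (value_ge0 Omega_open b2 A2 A_sympos M_ncim
  data).
split.
  move=> x O1x; split; last exact: (value_M Omega_open b2 A2 A_sympos M_ncim
    data).
  exact: (value_eq0 Omega_open b2 A2 A_sympos k0 M_ncim data).
split.
  split; first exact: (value_Ck Omega_open b2 A2 A_sympos M_ncim data).
  by move=> x; exact: (value_grad_F Omega_open b2 A2 A_sympos M_ncim data).
split.
  move=> x O1x; rewrite (value_grad_F Omega_open b2 A2 A_sympos M_ncim data)//.
  exact: (ud_H0 data (O1_sub data O1x)).
move=> x Mx; split.
- by move=> y; exact: (value_hess_ge0 Omega_open b2 A2 A_sympos M_ncim data).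
- by move=> y z; exact: (value_hess_tangent Omega_open b2 A2 A_sympos M_ncim
  data).
- by move=> y; exact: (value_hess_gt0 Omega_open b2 A2 A_sympos M_ncim data).
Qed.
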